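(* Let $H$ and $K$ be complex Hilbert spaces, $\dim K<\infty$, and let $\mathcal{B}$ be the open unit ball of the space $L(K,H)$ of bounded linear operators from $K$ to $H$ (with the operator norm). If a group $G$ of biholomorphic automorphisms of $\mathcal{B}$ has at least one orbit separated from the boundary, then it has a fixed point, i.e. there is a point of $\mathcal{B}$ fixed by all elements of $G$.
   Context: The orbit of $X\in\mathcal{B}$ is $G(X)=\{g(X):g\in G\}$. A subset of $\mathcal{B}$ is separated from the boundary if there is $r<1$ such that all its elements have norm at most $r$. A biholomorphic automorphism of $\mathcal{B}$ is a holomorphic bijection of $\mathcal{B}$ onto itself with holomorphic inverse. *)

(* Defs.v *)
From HB Require Import structures.
From mathcomp Require Import all_boot all_order all_algebra.
From mathcomp Require Import complex.
From mathcomp Require Import sesquilinear.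
From mathcomp Require Import all_classical all_reals all_analysis.
Set Implicit Arguments.
Unset Strict Implicit.
Unset Printing Implicit Defensive.
Import Order.TTheory GRing.Theory Num.Theory.
Import numFieldNormedType.Exports.
Local Open Scope classical_set_scope.
Local Open Scope complex_scope.
Local Open Scope ring_scope.

(* The inner product is linear in its first argument; norms take values in C. *)
HB.mixin Record isHilbert (C : numClosedFieldType) H
    of CompleteNormedModule C H := {
  hdot : {dot H for Num.conj} ;
  hdot_norm : forall x : H, hdot x x = `|x| ^+ 2
}.

#[short(type="hilbertType")]
HB.structure Definition Hilbert (C : numClosedFieldType) :=
  {H of isHilbert C H & CompleteNormedModule C H}.

Definition finite_dimensional (F : fieldType) (V : lmodType F) : Prop :=
  exists n, inhabited (Vector.axiom n V).

Section BoundedOperators.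
Context (R : realType) (K H : normedModType R[i]).

Definition bounded_operator : {pred K -> H} :=
  fun f => `[< linear f /\ exists M : R[i], forall x, `|f x| <= M * `|x| >].

Lemma bounded_operatorP (f : K -> H) :
  reflect (linear f /\ exists M : R[i], forall x, `|f x| <= M * `|x|)
          (f \in bounded_operator).
Proof. exact: asboolP. Qed.

Lemma bounded_operator_submod : submod_closed bounded_operator.
Proof.
split=> [|a f g /bounded_operatorP[lf [M fM]] /bounded_operatorP[lg [N gN]]].
  apply/bounded_operatorP; split=> [b x y|]; first by rewrite /= scaler0 addr0.
  by exists 0 => x; rewrite normr0 mul0r.
apply/bounded_operatorP; split=> [b x y|].
  rewrite !addrfctE !scalrfctE lf lg !scalerDr !scalerA mulrC -!addrA.
  by congr (_ + _); rewrite addrCA.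
exists (`|a| * M + N) => x; rewrite addrfctE scalrfctE mulrDl.
apply: le_trans (ler_normD _ _) _; rewrite lerD// normrZ -mulrA.
exact: ler_wpM2l.
Qed.

HB.instance Definition _ :=
  GRing.isSubmodClosed.Build R[i] (K -> H) bounded_operator
    bounded_operator_submod.

Record bounded_op := BoundedOp {
  bop_fun :> K -> H ;
  bop_funP : bop_fun \in bounded_operator
}.

HB.instance Definition _ := [isSub for bop_fun].
HB.instance Definition _ := [Choice of bounded_op by <:].
HB.instance Definition _ := [SubChoice_isSubLmodule of bounded_op by <:].

Implicit Types f g : bounded_op.

Lemma bop_linear f : linear f.
Proof. by have /bounded_operatorP[] := bop_funP f. Qed.

HB.instance Definition _ f :=
  GRing.isLinear.Build R[i] K H *:%R f (bop_linear f).

Definition opnorm f : R :=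
  sup [set complex.Re `|f x| | x in [set x : K | `|x| <= 1]].

Lemma Re_normK (V : normedModType R[i]) (v : V) :
  (complex.Re `|v|)%:C = `|v|.
Proof. by apply/RRe_real/ger0_real. Qed.

Lemma opnorm_has_sup f :
  has_sup [set complex.Re `|f x| | x in [set x : K | `|x| <= 1]].
Proof.
split; first by exists (complex.Re `|f 0|), 0 => //=; rewrite normr0 ler01.
have /bounded_operatorP[_ [M fM]] := bop_funP f.
exists (complex.Re `|M|) => _ [x /= x1 <-]; rewrite -lecR !Re_normK.
apply: le_trans (fM x) _; apply: le_trans (_ : `|M| * `|x| <= _).
  have [->|x0] := eqVneq x 0; first by rewrite normr0 !mulr0.
  have x_gt0 : 0 < `|x| by rewrite normr_gt0.
  rewrite ler_wpM2r// real_ler_norm// ger0_real//.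
  by rewrite -(pmulr_lge0 _ x_gt0) (le_trans _ (fM x)).
by rewrite ler_piMr.
Qed.

Lemma opnormP f x : `|f x| <= (opnorm f)%:C * `|x|.
Proof.
have [->|x0] := eqVneq x 0; first by rewrite linear0 !normr0 mulr0.
have x_gt0 : 0 < `|x| by rewrite normr_gt0.
rewrite -ler_pdivrMr//.
have -> : `|f x| / `|x| = `|f (`|x|^-1 *: x)|.
  by rewrite linearZ normrZ ger0_norm ?invr_ge0// mulrC.
rewrite -Re_normK lecR; apply: ub_le_sup; first exact: (opnorm_has_sup f).2.
exists (`|x|^-1 *: x) => //=.
by rewrite normrZ ger0_norm ?invr_ge0// mulVf// gt_eqF.
Qed.

Lemma opnorm_le f (M : R) : 0 <= M ->
  (forall x, `|f x| <= M%:C * `|x|) -> opnorm f <= M.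
Proof.
move=> M0 fM; apply: ge_sup; first exact: (opnorm_has_sup f).1.
move=> _ [x /= x1 <-]; rewrite -lecR Re_normK (le_trans (fM x))//.
by rewrite ler_piMr// lecR.
Qed.

Lemma opnorm_ge0 f : 0 <= opnorm f.
Proof.
apply: ub_le_sup; first exact: (opnorm_has_sup f).2.
by exists 0; rewrite /= ?normr0 ?linear0 ?normr0 ?ler01.
Qed.

Let bop_norm f : R[i] := (opnorm f)%:C.

Let bop_normD f g : bop_norm (f + g) <= bop_norm f + bop_norm g.
Proof.
rewrite /bop_norm -rmorphD lecR opnorm_le ?addr_ge0 ?opnorm_ge0// => x.
by rewrite (le_trans (ler_normD _ _))// rmorphD mulrDl lerD ?opnormP.
Qed.

Let bop_normZ (a : R[i]) f : bop_norm (a *: f) = `|a| * bop_norm f.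
Proof.
have leZ b g : bop_norm (b *: g) <= `|b| * bop_norm g.
  have bE : (complex.Re `|b|)%:C = `|b| by apply/RRe_real/ger0_real.
  rewrite /bop_norm -bE -rmorphM lecR opnorm_le//.
    by rewrite mulr_ge0 ?opnorm_ge0// -lecR bE rmorph0 normr_ge0.
  move=> x; rewrite rmorphM /= bE -mulrA.
  rewrite [X in `|X|](_ : _ = b *: g x)// normrZ.
  by rewrite ler_wpM2l ?opnormP.
apply/eqP; rewrite eq_le leZ /=.
have [->|a0] := eqVneq a 0.
  by rewrite normr0 mul0r /bop_norm lecR opnorm_ge0.
rewrite -ler_pdivlMl ?normr_gt0// -normfV.
by rewrite -{1}[f]scale1r -(mulVf a0) -scalerA leZ.
Qed.

Let bop_norm0_eq0 f : bop_norm f = 0 -> f = 0.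
Proof.
move=> /complexI f0; apply/val_inj/funext => x /=; apply/normr0_eq0.
by apply/eqP; rewrite eq_le normr_ge0 andbT (le_trans (opnormP f x))// f0 mul0r.
Qed.

HB.instance Definition _ := Lmodule_isNormed.Build R[i] bounded_op
  bop_normD bop_normZ bop_norm0_eq0.

Lemma bop_normE f : `|f| = (opnorm f)%:C.
Proof. by []. Qed.

End BoundedOperators.

Notation "''L' ( K , H )" := (bounded_op K H)
  (at level 8, format "''L' ( K ,  H )") : type_scope.

Section UnitBall.
Context (R : realType) (V : normedModType R[i]).

Definition unit_ball := {X : V | `|X| < 1}.

(* Differentiability at a point of the open ball does not depend on the
   values taken outside the ball, here set to 0. *)
Definition extend0 (g : unit_ball -> unit_ball) : V -> V :=
  fun X => if insub X is Some Y then val (g Y) else 0.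

(* The scalar field being R[i], differentiability is complex
   Frechet-differentiability. *)
Definition holomorphic (g : unit_ball -> unit_ball) : Prop :=
  forall X : unit_ball, differentiable (extend0 g) (val X).

Definition biholomorphic_automorphism (g : unit_ball -> unit_ball) : Prop :=
  exists h, [/\ cancel g h, cancel h g, holomorphic g & holomorphic h].

Definition automorphism_group (G : set (unit_ball -> unit_ball)) : Prop :=
  [/\ forall g, G g -> biholomorphic_automorphism g,
      G id,
      forall g h, G g -> G h -> G (g \o h) &
      forall g, G g -> exists2 h, G h & cancel g h /\ cancel h g].

Definition group_orbit (G : set (unit_ball -> unit_ball)) (X : unit_ball) :
  set unit_ball := [set g X | g in G].

Definition separated_from_boundary (A : set unit_ball) : Prop :=
  exists2 r : R, r < 1 & forall X, A X -> `|val X| <= r%:C.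

Definition fixed_point (G : set (unit_ball -> unit_ball)) (X : unit_ball) :
  Prop := forall g, G g -> g X = X.

End UnitBall.

(* Main.v *)
From HB Require Import structures.
Require Import Defs.
From mathcomp Require Import all_boot all_order all_algebra.
From mathcomp Require Import complex.
From mathcomp Require Import all_classical all_reals all_analysis.
From mathcomp Require Import ring lra.
Set Implicit Arguments.
Unset Strict Implicit.
Unset Printing Implicit Defensive.
Import Order.TTheory GRing.Theory Num.Theory.
Import numFieldNormedType.Exports.
Local Open Scope classical_set_scope.
Local Open Scope complex_scope.
Local Open Scope ring_scope.

(** A group with an orbit away from the boundary acts by isometries of the
    Caratheodory distance of the ball, and leaves a bounded convex set invariant.
    The fixed point is found as in the theorem of Brodskii and Milman: a minimal
    invariant convex set with more than one point would have a non-diametral point,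
    and the set of such points would be invariant and smaller.

    The distance enters only through the relation [cosh2_le c X Y],
      [|<u, a> - <Y u, X a>| ^ 2 <= c (|u| ^ 2 - |Y u| ^ 2) (|a| ^ 2 - |X a| ^ 2)]
    for all [u] and [a] in [K], which says that the distance of [X] and [Y] is at most
    the number whose hyperbolic cosine is the square root of [c]. Geometrically it
    compares the graphs of [X] and [Y], which are positive subspaces of the direct sum
    of [K] and [H] for the form [|k| ^ 2 - |h| ^ 2]. Two properties make the argument
    work.

    Holomorphic maps of the ball into itself preserve the relation
    ([cosh2_le_holomorphic]). There is a holomorphic disc through [X] and [Y]
    ([geodesic_disc]), and a holomorphic disc in the ball satisfies the Schwarz-Pick
    inequality ([schwarz_pick]), which follows from the scalar Schwarz lemma applied
    to suitable matrix coefficients. Holomorphy means mere differentiability, so that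
    the maximum principle behind the Schwarz lemma rests on a version of Goursat's
    theorem ([goursat]).

    For fixed [X], [u] and [a] the relation is a condition on the vector [Y u] alone, and
    it is uniformly convex in that vector ([slack_midpoint]). Hence balls are closed
    and convex for the linear structure of the space of operators. As [K] has finite
    dimension, this space is a Hilbert space for the Hilbert-Schmidt norm, so that
    chains of such sets have nonempty intersections ([chain_intersection]) and minimal
    invariant sets exist by Zorn's lemma. Compactness of the unit sphere of [K] turns
    uniform convexity in each direction [u] into the existence of non-diametral points
    ([nondiametral]). *)

(** * Deciding equalities of linear combinations *)

Section LinearCombinations.
Context {K : comNzRingType} {V : lmodType K}.

(** Syntax of linear combinations of the vectors of an environment; it lets
    equalities in a module be reduced to ring equalities between scalars. *)
Inductive lexp :=
  LVar of nat | LZero | LAdd of lexp & lexp | LOpp of lexp | LScale of K & lexp.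

Fixpoint leval (xs : seq V) (e : lexp) : V :=
  match e with
  | LVar n => xs`_n
  | LZero => 0
  | LAdd e1 e2 => leval xs e1 + leval xs e2
  | LOpp e1 => - leval xs e1
  | LScale a e1 => a *: leval xs e1
  end.

Fixpoint lcoef (e : lexp) (i : nat) : K :=
  match e with
  | LVar n => if eqn i n then 1 else 0
  | LZero => 0
  | LAdd e1 e2 => lcoef e1 i + lcoef e2 i
  | LOpp e1 => - lcoef e1 i
  | LScale a e1 => a * lcoef e1 i
  end.

Lemma levalE xs e : leval xs e = \sum_(i < size xs) lcoef e i *: xs`_i.
Proof.
elim: e => [n||e1 IH1 e2 IH2|e1 IH1|a e1 IH1] /=.
- have eqbE (i : nat) : (if eqn i n then 1 else 0) = (i == n)%:R :> K.
    by rewrite -[eqn i n]/(i == n); case: (i == n).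
  have [n_lt|n_ge] := ltnP n (size xs).
    rewrite (bigD1 (Ordinal n_lt))//= eqbE eqxx scale1r big1 ?addr0// => i.
    by rewrite eqbE -val_eqE /= => /negPf ->; rewrite scale0r.
  rewrite nth_default// big1// => i _; rewrite eqbE.
  by rewrite ltn_eqF ?scale0r// (leq_trans (ltn_ord i)).
- by rewrite big1// => i _; rewrite scale0r.
- by rewrite IH1 IH2 -big_split; apply: eq_bigr => i _; rewrite scalerDl.
- by rewrite IH1 -sumrN; apply: eq_bigr => i _; rewrite scaleNr.
- by rewrite IH1 scaler_sumr; apply: eq_bigr => i _; rewrite scalerA.
Qed.

Fixpoint lcoef_eq (n : nat) (e1 e2 : lexp) : Prop :=
  if n is m.+1 then lcoef e1 m = lcoef e2 m /\ lcoef_eq m e1 e2 else True.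

Lemma leval_eq xs e1 e2 : lcoef_eq (size xs) e1 e2 -> leval xs e1 = leval xs e2.
Proof.
move=> h; rewrite !levalE; apply: eq_bigr => i _; congr (_ *: _).
case: i => i /=; elim: (size xs) h => //= n IH [h1 h2].
by rewrite ltnS leq_eqVlt => /predU1P[->//|]; exact: IH.
Qed.

End LinearCombinations.

Ltac lmod_mem x xs :=
  lazymatch xs with
  | nil => constr:(false)
  | cons x _ => constr:(true)
  | cons _ ?xs' => lmod_mem x xs'
  end.

Ltac lmod_index x xs :=
  lazymatch xs with
  | cons x _ => constr:(O)
  | cons _ ?xs' => let n := lmod_index x xs' in constr:(S n)
  end.

Ltac lmod_atoms xs t :=
  lazymatch t with
  | (?a + ?b)%R => let ys := lmod_atoms xs a in lmod_atoms ys b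
  | (- ?a)%R => lmod_atoms xs a
  | (?k *: ?a)%R => lmod_atoms xs a
  | 0%R => xs
  | _ => lazymatch lmod_mem t xs with
         | true => xs
         | false => constr:(cons t xs)
         end
  end.

Ltac lmod_reify K xs t :=
  lazymatch t with
  | (?a + ?b)%R => let e1 := lmod_reify K xs a in
      let e2 := lmod_reify K xs b in constr:(@LAdd K e1 e2)
  | (- ?a)%R => let e := lmod_reify K xs a in constr:(@LOpp K e)
  | (?k *: ?a)%R => let e := lmod_reify K xs a in constr:(@LScale K k e)
  | 0%R => constr:(@LZero K)
  | _ => let n := lmod_index t xs in constr:(@LVar K n)
  end.

Ltac lmod_with K :=
  lazymatch goal with |- @eq ?T ?s ?t =>
    let xs := lmod_atoms (@nil T) s in
    let ys := lmod_atoms xs t in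
    let e1 := lmod_reify K ys s in
    let e2 := lmod_reify K ys t in
    apply: (@leval_eq K _ ys e1 e2);
    cbv [lcoef_eq lcoef size eqn];
    repeat (split; [ring|]); exact I
  end.

(** Proves an equality between linear combinations of vectors over R[i] by
    comparing the coefficients of every vector that occurs in it. *)
Ltac lmod := lazymatch goal with R : realType |- _ => lmod_with (complex R) end.

(** * Goursat's theorem by midpoint sums *)

Section Goursat.
Context {R : realType}.
Implicit Types (U V : R -> R -> R) (phi psi : R -> R).

(** Midpoint sum of [phi] over the [2 ^ n] equal pieces of [[x, x + s]]. Such sums
    can stand for the integral along a side of a square: all that Goursat's
    argument asks of an integral is additivity under bisection, linearity and
    monotonicity, and these hold exactly at every level [n]. *)
Fixpoint edge n phi (x s : R) : R :=
  if n is m.+1 then edge m phi x (s / 2) + edge m phi (x + s / 2) (s / 2)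
  else s * phi (x + s / 2).

Lemma edge_cst n (a x s : R) : edge n (fun=> a) x s = s * a.
Proof. by elim: n x s => //= n IH x s; rewrite !IH; field. Qed.

Lemma edgeB n phi psi x s :
  edge n (fun t => phi t - psi t) x s = edge n phi x s - edge n psi x s.
Proof. by elim: n x s => [|n IH] x s /=; [ring | rewrite !IH; ring]. Qed.

Lemma edge_le n phi psi x s : 0 <= s ->
  (forall t, x <= t <= x + s -> phi t <= psi t) ->
  edge n phi x s <= edge n psi x s.
Proof.
elim: n x s => [|n IH] x s s0 le_ff /=.
  by rewrite ler_wpM2l// le_ff//; apply/andP; split; lra.
by apply: lerD; apply: IH; rewrite ?divr_ge0// => t /andP[t1 t2];
  apply: le_ff; apply/andP; split; lra.
Qed.

Lemma edge_le_cst n phi x s a : 0 <= s ->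
  (forall t, x <= t <= x + s -> phi t <= a) -> edge n phi x s <= s * a.
Proof. by move=> s0 le_fa; rewrite -(edge_cst n a x s); exact: edge_le. Qed.

(** Discrete version of the imaginary part of the integral of [(U + iV) dz] along
    the positively oriented boundary of the square with lower left corner
    [(x, y)] and side [s]. *)
Definition circulation n U V (x y s : R) : R :=
  edge n (V^~ y) x s - edge n (V^~ (y + s)) x s
  + edge n (U (x + s)) y s - edge n (U x) y s.

(** The inner sides are run through twice in opposite directions, with the same
    sample points, so that they cancel. *)
Lemma circulationS n U V x y s :
  circulation n.+1 U V x y s =
    circulation n U V x y (s / 2)
    + circulation n U V (x + s / 2) y (s / 2)
    + circulation n U V x (y + s / 2) (s / 2)
    + circulation n U V (x + s / 2) (y + s / 2) (s / 2).
Proof.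
by rewrite /circulation /= -!addrA -!splitr; ring.
Qed.

(** Complex differentiability at [x + iy] of [U + iV], the derivative being
    [p + iq], in real terms. *)
Definition cauchy_riemann U V x y := exists p q : R, forall e : R, 0 < e ->
  exists2 d : R, 0 < d & forall x' y' : R, `|x' - x| < d -> `|y' - y| < d ->
  `|U x' y' - U x y - (p * (x' - x) - q * (y' - y))|
    <= e * (`|x' - x| + `|y' - y|) /\
  `|V x' y' - V x y - (q * (x' - x) + p * (y' - y))|
    <= e * (`|x' - x| + `|y' - y|).

(** The circulation of an affine holomorphic function is zero at every level, and
    the remainder is of smaller order than the side of the square. *)
Lemma circulation_small U V x0 y0 (c : R) : cauchy_riemann U V x0 y0 -> 0 < c ->
  exists2 d : R, 0 < d & forall n x y s, 0 < s < d ->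
    x <= x0 <= x + s -> y <= y0 <= y + s ->
    circulation n U V x y s < c * s ^+ 2.
Proof.
move=> [p [q crUV]] c0.
(* The remainder contributes at most c / 4 times s ^ 2 on each pair of
   opposite sides. *)
have [d d0 {}crUV] := crUV (c / 16) ltac:(lra).
exists d => // n x y s /andP[s0 sd] /andP[xl xr] /andP[yl yr].
have near x' y' : x <= x' <= x + s -> y <= y' <= y + s ->
  `|U x' y' - U x0 y0 - (p * (x' - x0) - q * (y' - y0))| <= c / 8 * s /\
  `|V x' y' - V x0 y0 - (q * (x' - x0) + p * (y' - y0))| <= c / 8 * s.
  move=> /andP[x1 x2] /andP[y1 y2].
  have hx : `|x' - x0| <= s by rewrite ler_norml; apply/andP; split; lra.
  have hy : `|y' - y0| <= s by rewrite ler_norml; apply/andP; split; lra.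
  have [hU hV] := crUV x' y' (le_lt_trans hx sd) (le_lt_trans hy sd).
  have le_s : c / 16 * (`|x' - x0| + `|y' - y0|) <= c / 8 * s by nra.
  by split; [apply: le_trans hU _ | apply: le_trans hV _].
have hor : edge n (V^~ y) x s - edge n (V^~ (y + s)) x s
    <= s * (- p * s + c / 4 * s).
  rewrite -edgeB; apply: edge_le_cst; first exact: ltW.
  move=> t xt.
  have [_] := near t y xt ltac:(apply/andP; split; lra).
  have [_] := near t (y + s) xt ltac:(apply/andP; split; lra).
  rewrite !ler_norml => /andP[h1 h2] /andP[h3 h4]; nra.
have ver : edge n (U (x + s)) y s - edge n (U x) y s
    <= s * (p * s + c / 4 * s).
  rewrite -edgeB; apply: edge_le_cst; first exact: ltW.
  move=> t yt.
  have [+ _] := near x t ltac:(apply/andP; split; lra) yt.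
  have [+ _] := near (x + s) t ltac:(apply/andP; split; lra) yt.
  rewrite !ler_norml => /andP[h1 h2] /andP[h3 h4]; nra.
have s2 : 0 < c * s ^+ 2 by rewrite mulr_gt0// exprn_gt0.
rewrite /circulation -addrA; nra.
Qed.

(** If the circulation did not get small relative to the area, then by additivity
    it would not do so on one of the four quarters of the square either, hence
    neither on a nested sequence of squares; this contradicts
    [circulation_small] at their common point. *)
Lemma goursat U V x y s (c : R) : 0 < s -> 0 < c ->
  (forall x' y', x <= x' <= x + s -> y <= y' <= y + s ->
    cauchy_riemann U V x' y') ->
  exists n, circulation n U V x y s < c * s ^+ 2.
Proof.
move=> s0 c0 crUV; apply: contrapT => noN.
(* Large circulation at infinitely many levels: unlike large circulation at one
   level, this passes to a quarter of the square. *)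
pose bad (p : R * R) s' :=
  forall N, exists2 n, (N <= n)%N & c * s' ^+ 2 <= circulation n U V p.1 p.2 s'.
have bad0 : bad (x, y) s.
  by move=> N; exists N => //; rewrite leNgt; apply/negP => h; apply: noN; exists N.
pose quarter (p q : R * R) s' :=
  (q.1 = p.1 \/ q.1 = p.1 + s' / 2) /\ (q.2 = p.2 \/ q.2 = p.2 + s' / 2).
have step p s' : bad p s' -> exists2 q, quarter p q s' & bad q (s' / 2).
  move=> badp; apply: contrapT => nex.
  have good q : quarter p q s' -> exists N, forall n, (N <= n)%N ->
      circulation n U V q.1 q.2 (s' / 2) < c * (s' / 2) ^+ 2.
    move=> pq; apply: contrapT => nN; apply: nex; exists q => // N.
    apply: contrapT => nn; apply: nN; exists N => n Nn.
    by rewrite ltNge; apply/negP => h; apply: nn; exists n.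
  have [N1 h1] := good (p.1, p.2) (conj (or_introl erefl) (or_introl erefl)).
  have [N2 h2] := good (p.1 + s' / 2, p.2) (conj (or_intror erefl) (or_introl erefl)).
  have [N3 h3] := good (p.1, p.2 + s' / 2) (conj (or_introl erefl) (or_intror erefl)).
  have [N4 h4] := good (p.1 + s' / 2, p.2 + s' / 2) (conj (or_intror erefl) (or_intror erefl)).
  have [n0] := badp (maxn (maxn N1 N2) (maxn N3 N4)).+1; case: n0 => // n.
  rewrite ltnS !geq_max => /andP[/andP[n1 n2] /andP[n3 n4]].
  rewrite circulationS; apply/negP; rewrite -ltNge.
  have := h1 _ n1; have := h2 _ n2; have := h3 _ n3; have := h4 _ n4 => /=.
  lra.
have /choice[nxt nxtP] : forall a : (R * R) * R, exists q,
    bad a.1 a.2 -> quarter a.1 q a.2 /\ bad q (a.2 / 2).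
  move=> [p s']; have [badp|nb] := pselect (bad p s'); last by exists p.
  by have [q pq bq] := step p s' badp; exists q.
pose sq k := iter k (fun a : (R * R) * R => (nxt a, a.2 / 2)) ((x, y), s).
have sqbad k : bad (sq k).1 (sq k).2.
  by elim: k => [//|k IH] /=; have [] := nxtP _ IH.
have sqq k : quarter (sq k).1 (sq k.+1).1 (sq k).2.
  by have [] := nxtP _ (sqbad k).
have sqs k : (sq k).2 = s / 2 ^+ k.
  by elim: k => [|k IH] /=; rewrite ?divr1// IH exprS; field.
have sqs0 k : 0 < (sq k).2 by rewrite sqs divr_gt0// exprn_gt0.
have limP (u : nat -> R) :
    (forall k, u k.+1 = u k \/ u k.+1 = u k + (sq k).2 / 2) ->
    exists l, forall k, u k <= l <= u k + (sq k).2.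
  move=> hu.
  have mono k j : u k <= u (k + j)%N /\
      u (k + j)%N + (sq (k + j)%N).2 <= u k + (sq k).2.
    elim: j => [|j [IH1 IH2]]; first by rewrite addn0 !lexx.
    have := hu (k + j)%N; have := sqs0 (k + j)%N.
    rewrite addnS [(sq (k + j)%N.+1).2]/=.
    move=> sp [->|->]; split; lra.
  have cross j k : u j <= u k + (sq k).2.
    have [jk|kj] := leqP j k.
      have [h _] := mono j (k - j)%N; rewrite subnKC// in h.
      by have := sqs0 k; lra.
    have [_ h] := mono k (j - k)%N; rewrite subnKC// in h; last exact: ltnW.
    by have := sqs0 j; lra.
  exists (sup (range u)) => k; apply/andP; split.
    apply: ub_le_sup; last by exists k.
    by exists (u k + (sq k).2) => _ [j _ <-]; exact: cross.
  apply: ge_sup; first by exists (u 0%N), 0%N.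
  by move=> _ [j _ <-]; exact: cross.
have [x0 x0P] := limP (fun k => (sq k).1.1) (fun k => (sqq k).1).
have [y0 y0P] := limP (fun k => (sq k).1.2) (fun k => (sqq k).2).
have [d d0 small] := circulation_small (crUV _ _ (x0P 0%N) (y0P 0%N)) c0.
have [k sk] : exists k, (sq k).2 < d.
  have [m hm] : exists m : nat, s / d < m%:R.
    by exists (Num.bound (s / d)); apply: archi_boundP; rewrite divr_ge0// ltW.
  exists m; rewrite sqs ltr_pdivrMr ?exprn_gt0// mulrC -ltr_pdivrMr//.
  apply: lt_le_trans hm _.
  by rewrite -natrX ler_nat ltnW// ltn_expl.
have [n _] := sqbad k 0%N; apply/negP; rewrite -ltNge.
by apply: small; rewrite ?sqs0.
Qed.

End Goursat.

(** * Real-valued norms and complex derivatives *)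

Section RealNorm.
Context {R : realType}.

(** The norm takes its values in R[i]; this is the same norm with values in R,
    where linear arithmetic is available. *)
Definition nr (V : normedZmodType R[i]) (v : V) : R := complex.Re `|v|.

Section NormedZmod.
Context {V : normedZmodType R[i]}.
Implicit Types u v : V.

Lemma nrE v : (nr v)%:C = `|v|.
Proof. by apply/RRe_real/ger0_real. Qed.

Lemma nr_ge0 v : 0 <= nr v.
Proof. by rewrite -lecR nrE normr_ge0. Qed.

Lemma nrD u v : nr (u + v) <= nr u + nr v.
Proof. by rewrite -lecR rmorphD /= !nrE ler_normD. Qed.

Lemma nr0 : nr (0 : V) = 0.
Proof. by rewrite /nr normr0. Qed.

Lemma nrN v : nr (- v) = nr v.
Proof. by rewrite /nr normrN. Qed.

Lemma nrB u v : nr (u - v) <= nr u + nr v.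
Proof. by rewrite -(nrN v) nrD. Qed.

Lemma nr_distC u v : nr (u - v) = nr (v - u).
Proof. by rewrite -nrN opprB. Qed.

Lemma nr_eq0 v : nr v = 0 -> v = 0.
Proof. by move=> h; apply/normr0_eq0; rewrite -nrE h. Qed.

Lemma nr_gt0 v : v != 0 -> 0 < nr v.
Proof.
move=> v0; rewrite lt_neqAle nr_ge0 andbT eq_sym.
by apply: contra_neq v0; exact: nr_eq0.
Qed.

End NormedZmod.

Lemma nrZ (V : normedModType R[i]) (a : R[i]) (v : V) : nr (a *: v) = nr a * nr v.
Proof. by apply: complexI; rewrite rmorphM /= !nrE normrZ. Qed.

Lemma nrM (a b : R[i]) : nr (a * b) = nr a * nr b.
Proof. by apply: complexI; rewrite rmorphM /= !nrE normrM. Qed.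

Lemma nr1 : nr (1 : R[i]) = 1.
Proof. by apply: complexI; rewrite nrE normr1. Qed.

Lemma nrX (a : R[i]) n : nr (a ^+ n) = nr a ^+ n.
Proof. by elim: n => [|n IH]; rewrite ?expr0 ?nr1// !exprS nrM IH. Qed.

Lemma nrV (a : R[i]) : nr a^-1 = (nr a)^-1.
Proof.
have [->|a0] := eqVneq a 0; first by rewrite invr0 nr0 invr0.
have a0' : nr a != 0 by rewrite gt_eqF// nr_gt0.
by apply: (mulIf a0'); rewrite -nrM !mulVf// nr1.
Qed.

Lemma nr_real (x : R) : nr x%:C = `|x|.
Proof. by rewrite /nr normc_def /= expr0n addr0 sqrtr_sqr. Qed.

Lemma Re_gt0 (c : R[i]) : 0 < c -> (complex.Re c)%:C = c /\ 0 < complex.Re c.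
Proof.
move=> c0; have cE : (complex.Re c)%:C = c by apply/RRe_real/gtr0_real.
by split; rewrite // -ltcR cE.
Qed.

Lemma nr_sqr (z : R[i]) : nr z ^+ 2 = complex.Re z ^+ 2 + complex.Im z ^+ 2.
Proof. by apply: complexI; rewrite rmorphXn /= nrE add_Re2_Im2. Qed.

Lemma Re_le_nr (z : R[i]) : `|complex.Re z| <= nr z.
Proof.
rewrite -(@ler_pXn2r _ 2) ?nnegrE ?nr_ge0//.
by rewrite nr_sqr real_normK ?num_real// lerDl sqr_ge0.
Qed.

Lemma Im_le_nr (z : R[i]) : `|complex.Im z| <= nr z.
Proof.
rewrite -(@ler_pXn2r _ 2) ?nnegrE ?nr_ge0//.
by rewrite nr_sqr real_normK ?num_real// lerDr sqr_ge0.
Qed.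

Lemma nr_le_ReIm (z : R[i]) : nr z <= `|complex.Re z| + `|complex.Im z|.
Proof.
rewrite -(@ler_pXn2r _ 2) ?nnegrE ?nr_ge0 ?addr_ge0//.
rewrite nr_sqr -(real_normK (num_real (complex.Re z))).
rewrite -(real_normK (num_real (complex.Im z))).
have := normr_ge0 (complex.Re z); have := normr_ge0 (complex.Im z); nra.
Qed.

End RealNorm.

Section ComplexDerivative.
Context {R : realType}.

Definition cderiv (W : normedModType R[i]) (f : R[i] -> W) z (d : W) :=
  forall e : R, 0 < e -> exists2 r : R, 0 < r & forall w, nr (w - z) < r ->
    nr (f w - f z - (w - z) *: d) <= e * nr (w - z).

Definition cdiff (W : normedModType R[i]) (f : R[i] -> W) z :=
  exists d, cderiv f z d.

Section Generic.
Context {W : normedModType R[i]}.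
Implicit Types f g : R[i] -> W.

Lemma cderiv_lip f z d : cderiv f z d ->
  exists2 r : R, 0 < r & forall w, nr (w - z) < r ->
    nr (f w - f z) <= (nr d + 1) * nr (w - z).
Proof.
move=> /(_ 1 ltr01)[r r0 fd]; exists r => // w wz.
rewrite -(subrK ((w - z) *: d) (f w - f z)).
apply: le_trans (nrD _ _) _.
by rewrite nrZ mulrDl mul1r addrC (mulrC (nr d)) lerD2l (le_trans (fd w wz))// mul1r.
Qed.

Lemma cderiv_quad f z d (r C : R) : 0 < r ->
  (forall w, nr (w - z) < r ->
    nr (f w - f z - (w - z) *: d) <= C * nr (w - z) ^+ 2) -> cderiv f z d.
Proof.
move=> r0 fC e e0.
pose C' := `|C| + 1; have C'0 : 0 < C' by rewrite /C' ltr_wpDl.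
exists (Num.min r (e / C')); first by rewrite lt_min r0 divr_gt0.
move=> w; rewrite lt_min => /andP[wr we]; apply: le_trans (fC w wr) _.
rewrite expr2 mulrA ler_wpM2r ?nr_ge0//.
rewrite ltr_pdivlMr// in we.
have := nr_ge0 (w - z); have := ler_norm C; rewrite /C' in we.
by nra.
Qed.

Lemma cdiff_cst (a : W) z : cdiff (fun=> a) z.
Proof.
exists 0 => e e0; exists 1 => // w _.
by rewrite subrr scaler0 subr0 nr0 mulr_ge0 ?nr_ge0// ltW.
Qed.

Lemma cderivD f g z d d' :
  cderiv f z d -> cderiv g z d' -> cderiv (fun w => f w + g w) z (d + d').
Proof.
move=> fd gd e e0; have e2 : 0 < e / 2 by lra.
have [r r0 {}fd] := fd _ e2; have [s s0 {}gd] := gd _ e2.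
exists (Num.min r s); first by rewrite lt_min r0.
move=> w; rewrite lt_min => /andP[wr ws].
have -> : f w + g w - (f z + g z) - (w - z) *: (d + d') =
  (f w - f z - (w - z) *: d) + (g w - g z - (w - z) *: d').
  by lmod.
apply: le_trans (nrD _ _) _.
have := fd w wr; have := gd w ws; lra.
Qed.

End Generic.

Lemma cderiv_bilin (A B W : normedModType R[i]) (b : A -> B -> W) (C : R)
    (f : R[i] -> A) (g : R[i] -> B) z d d' :
  (forall k x x' y, b (k *: x + x') y = k *: b x y + b x' y) ->
  (forall k x y y', b x (k *: y + y') = k *: b x y + b x y') ->
  0 <= C -> (forall x y, nr (b x y) <= C * nr x * nr y) ->
  cderiv f z d -> cderiv g z d' ->
  cderiv (fun w => b (f w) (g w)) z (b d (g z) + b (f z) d').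
Proof.
move=> bl br C0 bC fd gd.
have blB x x' y : b (x - x') y = b x y - b x' y.
  by rewrite addrC -scaleN1r bl scaleN1r addrC.
have brB x y y' : b x (y - y') = b x y - b x y'.
  by rewrite addrC -scaleN1r br scaleN1r addrC.
have b0l y : b 0 y = 0 by rewrite -(subrr 0) blB subrr.
have b0r x : b x 0 = 0 by rewrite -(subrr 0) brB subrr.
have blZ k x y : b (k *: x) y = k *: b x y.
  by rewrite -[k *: x]addr0 bl b0l addr0.
have brZ k x y : b x (k *: y) = k *: b x y.
  by rewrite -[k *: y]addr0 br b0r addr0.
move=> e e0.
pose D := C * (nr (g z) + nr (f z)) + 1.
have D0 : 0 < D by rewrite ltr_wpDl// mulr_ge0// addr_ge0 ?nr_ge0.
pose E := C * (nr d + 1) * (nr d' + 1) + 1.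
have E0 : 0 < E.
  by rewrite ltr_wpDl// !mulr_ge0// addr_ge0 ?nr_ge0.
have eD : 0 < e / 2 / D by rewrite !divr_gt0.
have [r1 r10 h1] := fd _ eD; have [r2 r20 h2] := gd _ eD.
have [r3 r30 h3] := cderiv_lip fd; have [r4 r40 h4] := cderiv_lip gd.
exists (Num.min (Num.min r1 r2) (Num.min (Num.min r3 r4) (e / 2 / E))).
  by rewrite !lt_min r10 r20 r30 r40 !divr_gt0.
move=> w; rewrite !lt_min => /andP[/andP[w1 w2] /andP[/andP[w3 w4] w5]].
set h := w - z in w1 w2 w3 w4 w5 *.
have -> : b (f w) (g w) - b (f z) (g z) - h *: (b d (g z) + b (f z) d') =
   b (f w - f z - h *: d) (g z) + b (f z) (g w - g z - h *: d')
   + b (f w - f z) (g w - g z).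
  by rewrite !blB !brB !blZ !brZ; lmod.
apply: le_trans (nrD _ _) _; apply: le_trans (lerD (nrD _ _) (lexx _)) _.
have k1 := h1 w w1; have k2 := h2 w w2; have k3 := h3 w w3.
have k4 := h4 w w4.
have m1 := bC (f w - f z - h *: d) (g z).
have m2 := bC (f z) (g w - g z - h *: d').
have m3 := bC (f w - f z) (g w - g z).
rewrite -/h in k1 k2 k3 k4 *.
have g0 := nr_ge0 (g z); have f0 := nr_ge0 (f z); have h0 := nr_ge0 h.
have n1 : C * nr (f w - f z - h *: d) * nr (g z) <=
    C * nr (g z) * (e / 2 / D * nr h).
  by rewrite mulrAC ler_wpM2l// mulr_ge0.
have n2 : C * nr (f z) * nr (g w - g z - h *: d') <=
    C * nr (f z) * (e / 2 / D * nr h).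
  by rewrite ler_wpM2l// mulr_ge0.
have n12 : C * nr (g z) * (e / 2 / D * nr h) + C * nr (f z) * (e / 2 / D * nr h)
    <= e / 2 * nr h.
  rewrite -mulrDl -mulrDr [X in _ <= X](_ : _ = D * (e / 2 / D * nr h)).
    by apply: ler_wpM2r; [rewrite mulr_ge0// ltW | rewrite /D; lra].
  by field; rewrite gt_eqF.
have n3 : C * nr (f w - f z) * nr (g w - g z) <=
    C * ((nr d + 1) * nr h) * ((nr d' + 1) * nr h).
  by rewrite ler_pM ?mulr_ge0 ?nr_ge0// ler_wpM2l.
have n4 : C * ((nr d + 1) * nr h) * ((nr d' + 1) * nr h) <= e / 2 * nr h.
  rewrite ltr_pdivlMr// in w5.
  rewrite [X in X <= _](_ : _ = (E - 1) * nr h * nr h); last by rewrite /E; ring.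
  by rewrite ler_wpM2r//; nra.
lra.
Qed.

Lemma cdiffM (f g : R[i] -> R[i]^o) z :
  cdiff f z -> cdiff g z -> cdiff (fun w => f w * g w : R[i]^o) z.
Proof.
move=> [d fd] [d' gd]; eexists.
apply: (@cderiv_bilin _ _ _ (fun x y : R[i]^o => x * y : R[i]^o) 1 _ _ _ _ _ _ _ _ _ fd gd) => //.
- by move=> k x x' y; rewrite mulrDl -scalerAl.
- by move=> k x y y'; rewrite mulrDr -scalerAr.
- by move=> x y; rewrite mul1r (@nrM R).
Qed.

Lemma cdiffX (f : R[i] -> R[i]^o) n z :
  cdiff f z -> cdiff (fun w => f w ^+ n : R[i]^o) z.
Proof.
move=> fd; elim: n => [|n IH]; first exact: (@cdiff_cst R[i]^o 1).
by under eq_fun do rewrite exprS; exact: cdiffM.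
Qed.

Lemma cdiffD (W : normedModType R[i]) (f g : R[i] -> W) z :
  cdiff f z -> cdiff g z -> cdiff (fun w => f w + g w) z.
Proof. by move=> [d fd] [d' gd]; exists (d + d'); exact: cderivD. Qed.

Lemma cdiff_id z : cdiff (fun w => w : R[i]^o) z.
Proof.
exists 1 => e e0; exists 1 => // w _.
by rewrite [_ *: _]mulr1 subrr nr0 mulr_ge0 ?nr_ge0// ltW.
Qed.

Lemma cdiff_sub (a z : R[i]) : cdiff (fun w => w - a : R[i]^o) z.
Proof. by apply: cdiffD; [exact: cdiff_id | exact: (@cdiff_cst R[i]^o)]. Qed.

Lemma cdiff_inv (a z : R[i]) : z != a -> cdiff (fun w => (w - a)^-1 : R[i]^o) z.
Proof.
move=> za; have za0 : z - a != 0 by rewrite subr_eq0.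
have n0 := nr_gt0 za0.
exists (- (z - a) ^- 2).
apply: (@cderiv_quad _ _ _ _ (nr (z - a) / 2) (2 / nr (z - a) ^+ 3)).
  by rewrite divr_gt0.
move=> w wz.
have wa : nr (z - a) / 2 < nr (w - a).
  have : nr (z - a) <= nr (w - a) + nr (w - z).
    by rewrite [z - a](_ : _ = (w - a) - (w - z)) ?nrB//; ring.
  by lra.
have wa0 : w - a != 0.
  apply/eqP => wa_eq0; rewrite wa_eq0 nr0 in wa.
  by have := nr_ge0 (z - a); lra.
rewrite [_ *: _]/(_ * _).
have -> : (w - a)^-1 - (z - a)^-1 - (w - z) * (- (z - a) ^- 2) =
    (w - z) ^+ 2 / ((z - a) ^+ 2 * (w - a)) by field; rewrite za0 wa0.
rewrite (@nrM R) (@nrV R) (@nrM R) !(@nrX R) mulrC ler_wpM2r ?exprn_ge0 ?nr_ge0//.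
rewrite -[2 / _]invrK invf_div lef_pV2 ?posrE ?divr_gt0 ?mulr_gt0 ?exprn_gt0//; last first.
  by apply: lt_trans wa; rewrite divr_gt0.
rewrite [X in X <= _](_ : _ = nr (z - a) ^+ 2 * (nr (z - a) / 2)); last by field.
by rewrite ler_wpM2l ?exprn_ge0 ?nr_ge0// ltW.
Qed.

(** A removable singularity that needs no continuity of derivatives: one of the
    two zeros cancels the pole, and the other makes the quotient
    differentiable. *)
Lemma cdiff_muldiv (f g : R[i] -> R[i]^o) (a z : R[i]) : f a = 0 -> g a = 0 ->
  cdiff f z -> cdiff g z -> cdiff (fun w => f w * g w / (w - a) : R[i]^o) z.
Proof.
move=> fa ga fd gd; move: fd gd; have [->|za] := eqVneq z a => fd gd; last first.
  by apply: cdiffM; [exact: cdiffM | exact: cdiff_inv].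
case: fd gd => [d fd] [d' gd].
exists (d * d') => e e0.
have [r3 r30 h3] := cderiv_lip gd.
pose D := nr d' + 1 + nr d; have D0 : 0 < D.
  by have := nr_ge0 d; have := nr_ge0 d'; rewrite /D; lra.
have eD : 0 < e / D by rewrite divr_gt0.
have [r1 r10 h1] := fd _ eD; have [r2 r20 h2] := gd _ eD.
exists (Num.min r1 (Num.min r2 r3)); first by rewrite !lt_min r10 r20.
move=> w; rewrite !lt_min => /and3P[w1 w2 w3].
have {h1} := h1 w w1; have {h2} := h2 w w2; have {h3} := h3 w w3.
rewrite fa ga !(subr0, mul0r).
have [->|wa0] := eqVneq w a.
  by rewrite fa subrr !(mul0r, scale0r, subr0, nr0, mulr0).
have wa : w - a != 0 by rewrite subr_eq0.
rewrite ![_ *: _]/(_ * _); set h := w - a in wa *.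
move=> h3 h2 h1.
have -> : f w * g w / h - h * (d * d') =
    ((f w - h * d) * g w + h * d * (g w - h * d')) / h by field.
have hn := nr_gt0 wa.
rewrite (@nrM R) (@nrV R) ler_pdivrMr//.
apply: le_trans (nrD _ _) _; rewrite !(@nrM R).
have -> : e * nr h * nr h = e / D * nr h * ((nr d' + 1) * nr h)
    + nr h * nr d * (e / D * nr h) by rewrite /D; field; rewrite gt_eqF.
apply: lerD; first by rewrite ler_pM ?nr_ge0.
by rewrite ler_wpM2l// mulr_ge0 ?nr_ge0.
Qed.

Lemma cdiff_cauchy_riemann (f : R[i] -> R[i]^o) (x y : R) : cdiff f (x +i* y) ->
  cauchy_riemann (fun s t => complex.Re (f (s +i* t)))
                 (fun s t => complex.Im (f (s +i* t))) x y.
Proof.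
move=> [[p q] fd]; exists p, q => e e0; have [r r0 {}fd] := fd e e0.
exists (r / 2); first by rewrite divr_gt0.
move=> x' y' xr yr.
have dist : nr ((x' +i* y') - (x +i* y)) <= `|x' - x| + `|y' - y|.
  exact: nr_le_ReIm.
have {fd} := fd (x' +i* y') ltac:(apply: le_lt_trans dist _; lra).
set E := f _ - f _ - _ => fE.
have le_e : nr E <= e * (`|x' - x| + `|y' - y|).
  by apply: le_trans fE _; rewrite ler_wpM2l// ltW.
have rE := le_trans (Re_le_nr E) le_e; have iE := le_trans (Im_le_nr E) le_e.
move: rE iE; rewrite /E; case: (f (x' +i* y')) => a b; case: (f (x +i* y)) => a' b'.
rewrite /= => rE iE; split.
  by rewrite [X in `|X|](_ : _ = a - a' + - ((x' - x) * p - (y' - y) * q)); [|ring].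
by rewrite [X in `|X|](_ : _ = b - b' + - ((x' - x) * q + (y' - y) * p)); [|ring].
Qed.

End ComplexDerivative.

(** * The maximum principle *)

Section MaximumPrinciple.
Context {R : realType}.

Lemma divcE (a b u v : R) : u ^+ 2 + v ^+ 2 != 0 ->
  (a +i* b) / (u +i* v) = ((a * u + b * v) / (u ^+ 2 + v ^+ 2)) +i*
                          ((b * u - a * v) / (u ^+ 2 + v ^+ 2)).
Proof.
move=> uv; apply/eqP; rewrite eq_complex; apply/andP; split; apply/eqP => /=.
  by field.
by field.
Qed.

(** The sign pattern is that of [1 / z] around the origin. *)
Lemma circulation_winding (U V : R -> R -> R) (n : nat) (x y h k : R) : 0 < h ->
  (forall t, x - h <= t <= x + h -> k <= V t (y - h)) ->
  (forall t, x - h <= t <= x + h -> V t (y + h) <= - k) ->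
  (forall t, y - h <= t <= y + h -> k <= U (x + h) t) ->
  (forall t, y - h <= t <= y + h -> U (x - h) t <= - k) ->
  8 * h * k <= circulation n U V (x - h) (y - h) (2 * h).
Proof.
move=> h0 bot top rgt lft; rewrite /circulation.
have E (z : R) : z - h + 2 * h = z + h by ring.
rewrite !E; have h2 : 0 <= 2 * h by lra.
have := @edge_le _ n (fun=> k) (V^~ (y - h)) (x - h) (2 * h) h2.
have := @edge_le_cst _ n (V^~ (y + h)) (x - h) (2 * h) (- k) h2.
have := @edge_le _ n (fun=> k) (U (x + h)) (y - h) (2 * h) h2.
have := @edge_le_cst _ n (U (x - h)) (y - h) (2 * h) (- k) h2.
rewrite !edge_cst !E => /(_ lft) a1 /(_ rgt) a2 /(_ top) a3 /(_ bot) a4.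
lra.
Qed.

Definition on_square (a : R[i]) (h : R) (z : R[i]) : Prop :=
  `|complex.Re (z - a)| <= h /\ `|complex.Im (z - a)| <= h.

Definition on_square_bd (a : R[i]) (h : R) (z : R[i]) : Prop :=
  on_square a h z /\ (`|complex.Re (z - a)| = h \/ `|complex.Im (z - a)| = h).

(** If [f] were small on the boundary, then [(f - 1) ^ 2 / (z - a)] would be close to
    [1 / (z - a)] there, hence have a circulation bounded away from zero; but this
    function is differentiable on the whole square, also at [a], so that its
    circulation vanishes. *)
Lemma square_not_small (f : R[i] -> R[i]^o) (a : R[i]) (h : R) : 0 < h ->
  (forall z, on_square a h z -> cdiff f z) -> f a = 1 ->
  (forall z, on_square_bd a h z -> nr (f z : R[i]) <= 1 / 5) -> False.
Proof.
move=> h0 fd fa fbd.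
have oneD (p q : R) : 1 + (p +i* q) = (1 + p) +i* q.
  by apply/eqP; rewrite eq_complex /= add0r !eqxx.
pose F z : R[i]^o := (f z - 1) * (f z - 1) / (z - a).
have Fd z : on_square a h z -> cdiff F z.
  move=> hz; have gd : cdiff (fun w => f w - 1 : R[i]^o) z.
    by apply: cdiffD; [exact: fd | exact: (@cdiff_cst _ R[i]^o)].
  by apply: cdiff_muldiv; rewrite ?fa ?subrr.
case: a => x y in fd fa fbd F Fd *.
pose U s t := complex.Re (F (s +i* t)); pose V s t := complex.Im (F (s +i* t)).
(* On the boundary (f - 1) ^ 2 = 1 + e with |e| <= (1/5) ^ 2 + 2/5 = 11/25. *)
have bd u v : `|u| <= h -> `|v| <= h -> `|u| = h \/ `|v| = h ->
  exists e1 e2, [/\ `|e1| <= 11 / 25, `|e2| <= 11 / 25,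
    U (x + u) (y + v) = ((1 + e1) * u + e2 * v) / (u ^+ 2 + v ^+ 2),
    V (x + u) (y + v) = (e2 * u - (1 + e1) * v) / (u ^+ 2 + v ^+ 2) &
    0 < u ^+ 2 + v ^+ 2 <= 2 * h ^+ 2].
  move=> hu hv huv; set z := (x + u) +i* (y + v).
  have zE : z - (x +i* y) = u +i* v.
    by apply/eqP; rewrite eq_complex /=; apply/andP; split; apply/eqP; ring.
  have /fbd fz : on_square_bd (x +i* y) h z.
    by rewrite /on_square_bd /on_square zE.
  pose e := (f z - 1) * (f z - 1) - 1.
  have ne : nr e <= 11 / 25.
    rewrite /e (_ : _ - 1 = f z * f z - (f z + f z)); last by ring.
    apply: le_trans (nrB _ _) _; rewrite (@nrM R).
    have := nrD (f z : R[i]) (f z); have := nr_ge0 (f z : R[i]); nra.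
  have n0 : 0 < u ^+ 2 + v ^+ 2.
    rewrite -(real_normK (num_real u)) -(real_normK (num_real v)).
    have := normr_ge0 u; have := normr_ge0 v.
    by case: huv => ->; nra.
  exists (complex.Re e), (complex.Im e); split.
  - exact: le_trans (Re_le_nr e) ne.
  - exact: le_trans (Im_le_nr e) ne.
  - rewrite /U /F -/z zE (_ : (f z - 1) * (f z - 1) = 1 + e); last by rewrite /e; ring.
    by case: e {ne} => e1 e2; rewrite oneD divcE ?gt_eqF.
  - rewrite /V /F -/z zE (_ : (f z - 1) * (f z - 1) = 1 + e); last by rewrite /e; ring.
    by case: e {ne} => e1 e2; rewrite oneD divcE ?gt_eqF.
  - rewrite n0 /=; move: hu hv; rewrite !ler_norml => /andP[? ?] /andP[? ?]; nra.
(* (14/25 h - 11/25 h) / (2 h ^ 2) is larger than this lower bound. *)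
pose k := (50 * h)^-1.
have k0 : 0 < k by rewrite invr_gt0; lra.
have kh : k * h = 1 / 50 by rewrite /k; field; rewrite gt_eqF.
have bound (p q n : R) : `|p| <= 11 / 25 * h -> 14 / 25 * h <= q ->
    0 < n <= 2 * h ^+ 2 -> k <= (q + p) / n.
  rewrite ler_norml => /andP[p1 p2] q1 /andP[n0 n1]; rewrite ler_pdivlMr//.
  nra.
have prod (e u : R) : `|e| <= 11 / 25 -> `|u| <= h -> `|e * u| <= 11 / 25 * h.
  by move=> e1 u1; rewrite normrM ler_pM.
have nh : `|h| <= h by rewrite ger0_norm// ltW.
have nNh : `|- h| <= h by rewrite normrN.
have eh : `|h| = h by rewrite ger0_norm// ltW.
have eNh : `|- h| = h by rewrite normrN.
have inh (c t : R) : c - h <= t <= c + h -> `|t - c| <= h.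
  by move=> /andP[t1 t2]; rewrite ler_norml; apply/andP; split; lra.
have big (e : R) : `|e| <= 11 / 25 -> 14 / 25 * h <= (1 + e) * h.
  by rewrite ler_norml => /andP[? ?]; nra.
have [n] := @goursat _ U V (x - h) (y - h) (2 * h) (2 * h * k / h ^+ 2) ltac:(lra)
  ltac:(by rewrite divr_gt0 ?exprn_gt0// !mulr_gt0)
  (fun s t hs ht => cdiff_cauchy_riemann (Fd (s +i* t)
     ltac:(by split; apply: inh => /=; move: hs ht => /andP[? ?] /andP[? ?];
            apply/andP; split; lra))).
apply/negP; rewrite -leNgt.
rewrite (_ : _ * (2 * h) ^+ 2 = 8 * h * k); last by field; rewrite gt_eqF.
apply: circulation_winding => // t /inh ht.
- have [e1 [e2 [E1 E2 _ VE n0]]] := bd (t - x) (- h) ht nNh (or_intror eNh).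
  rewrite addrC subrK in VE; rewrite VE.
  rewrite mulrN opprK addrC; apply: bound => //; [exact: prod | exact: big].
- have [e1 [e2 [E1 E2 _ VE n0]]] := bd (t - x) h ht nh (or_intror eh).
  rewrite addrC subrK in VE; rewrite VE.
  rewrite lerNr -mulNr opprB; apply: bound => //; last exact: big.
  by rewrite normrN; exact: prod.
- have [e1 [e2 [E1 E2 UE _ n0]]] := bd h (t - y) nh ht (or_introl eh).
  rewrite (addrC y) subrK in UE; rewrite UE.
  by apply: bound => //; [exact: prod | exact: big].
- have [e1 [e2 [E1 E2 UE _ n0]]] := bd (- h) (t - y) nNh ht (or_introl eNh).
  rewrite (addrC y) subrK in UE; rewrite UE.
  rewrite lerNr -mulNr opprD mulrN opprK; apply: bound => //; last exact: big.
  by rewrite normrN; exact: prod.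
Qed.

(** A high power of [f / f a] is small enough on the boundary for
    [square_not_small] to apply. *)
Lemma square_max (f : R[i] -> R[i]^o) (a : R[i]) (h theta : R) : 0 < h ->
  (forall z, on_square a h z -> cdiff f z) -> f a != 0 -> 0 <= theta < 1 ->
  (forall z, on_square_bd a h z ->
    nr (f z : R[i]) <= theta * nr (f a : R[i])) -> False.
Proof.
move=> h0 fd fa /andP[th0 th1] fbd.
have [N hN] : exists N, theta ^+ N <= 1 / 5.
  have th : `|theta| < 1 by rewrite ger0_norm.
  have /cvgrPdist_le/(_ (1 / 5) ltac:(lra)) := cvg_expr th.
  case=> N _ /(_ N (leqnn N)); rewrite sub0r normrN => hN.
  by exists N; apply: le_trans hN; exact: ler_norm.
apply: (@square_not_small (fun z => (f z / f a) ^+ N : R[i]^o) a h) => //.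
- move=> z hz; apply: cdiffX; apply: cdiffM; first exact: fd.
  exact: (@cdiff_cst _ R[i]^o).
- by rewrite divff// expr1n.
- move=> z /fbd fz; rewrite (@nrX R); apply: le_trans hN.
  apply: lerXn2r; rewrite ?nnegrE ?nr_ge0// (@nrM R) (@nrV R) ler_pdivrMr//.
  exact: nr_gt0.
Qed.

Lemma disc_max_attained (psi : R[i] -> R) (r : R) : 0 <= r ->
  (forall z, nr z <= r -> forall e : R, 0 < e -> exists2 d : R, 0 < d &
     forall w, nr (w - z) < d -> `|psi w - psi z| < e) ->
  exists2 a, nr a <= r & forall z, nr z <= r -> psi z <= psi a.
Proof.
move=> r0 cont.
pose T : Type := (R * R)%type.
pose D : set (R * R) := [set p | nr (p.1 +i* p.2) <= r].
pose B : set (R * R) := `[- r, r]%classic `*` `[- r, r]%classic.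
have cD : compact D.
  apply: (@subclosed_compact _ D B).
  - rewrite /D [X in closed X](_ : _ =
        (fun p : R * R => p.1 * p.1 + p.2 * p.2) @^-1` [set x | x <= r ^+ 2]).
      apply: closed_comp; last exact: closed_le.
      by move=> p _; apply: cvgD; apply: cvgM; [exact: cvg_fst|exact: cvg_fst|
        exact: cvg_snd|exact: cvg_snd].
    apply/seteqP; split=> p /=;
      by rewrite -[nr _ <= r](@ler_pXn2r _ 2) ?nnegrE ?nr_ge0// nr_sqr /= !expr2.
  - by apply: compact_setX; exact: segment_compact.
  - move=> p Dp; split; rewrite /= in_itv /= -ler_norml.
      exact: le_trans (Re_le_nr (p.1 +i* p.2)) Dp.
    exact: le_trans (Im_le_nr (p.1 +i* p.2)) Dp.
have [||p pD pmax] := @compact_EVT_max _ _ (fun p : R * R => psi (p.1 +i* p.2)) D _ cD.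
- by exists (0, 0); rewrite /D /= (_ : 0 +i* 0 = 0)// nr0.
- apply: continuous_in_subspaceT => p /set_mem pD.
  apply/cvgrPdist_lt => e e0; have [d d0 hd] := cont _ pD e e0.
  have d2 : 0 < d / 2 by rewrite divr_gt0.
  have : nbhs p (ball p (d / 2)) by apply: nbhsx_ballx.
  apply: filterS => q [q1 q2]; rewrite distrC; apply: hd.
  apply: le_lt_trans (nr_le_ReIm _) _ => /=.
  have {}q1 : `|p.1 - q.1| < d / 2 := q1.
  have {}q2 : `|p.2 - q.2| < d / 2 := q2.
  by rewrite distrC (distrC q.2); lra.
exists (p.1 +i* p.2); first exact: set_mem.
by move=> [x y] zr; apply: (pmax (x, y)); exact: mem_set.
Qed.

(** Were the maximum principle false, [|f z| (1 + eta |z| ^ 2)] would for a small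
    [eta] reach its maximum over the disc at an interior point [a]. With
    [w = eta (conj a) / (1 + eta |a| ^ 2)] one has
    [|1 + w (z - a)| ^ 2 =
     (1 + eta |z| ^ 2) / (1 + eta |a| ^ 2) - eta |z - a| ^ 2 / (1 + eta |a| ^ 2) ^ 2],
    so that [f z (1 + w (z - a)) ^ 2] is on the boundary of a square around [a]
    smaller than at [a] by a constant factor, against [square_max]. *)
Lemma disc_max (f : R[i] -> R[i]^o) (r M : R) : 0 < r ->
  (forall z, nr z <= r -> cdiff f z) ->
  (forall z, nr z = r -> nr (f z : R[i]) <= M) ->
  forall z, nr z <= r -> nr (f z : R[i]) <= M.
Proof.
move=> r0 fd fbd z0 z0r; rewrite leNgt; apply/negP => Mz0.
have M0 : 0 <= M.
  apply: le_trans (fbd r%:C _); first exact: nr_ge0.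
  by rewrite nr_real gtr0_norm.
pose eta := (nr (f z0 : R[i]) - M) / (2 * (M + 1) * r ^+ 2).
have eta0 : 0 < eta.
  by rewrite divr_gt0 ?subr_gt0// !mulr_gt0 ?exprn_gt0//; lra.
have etaP : M * (1 + eta * r ^+ 2) < nr (f z0 : R[i]).
  have -> : eta * r ^+ 2 = (nr (f z0 : R[i]) - M) / (2 * (M + 1)).
    by rewrite /eta; field; rewrite !gt_eqF//; lra.
  rewrite mulrDr mulr1 mulrA -ltrBrDl ltr_pdivrMr; last by lra.
  by nra.
pose psi z := nr (f z : R[i]) * (1 + eta * nr z ^+ 2).
have [|a ar amax] := @disc_max_attained psi r (ltW r0).
  move=> z zr e e0; have [d0 /cderiv_lip[r1 r10 lip]] := fd z zr.
  set L := nr d0 + 1 in lip; have L0 : 0 <= L by rewrite addr_ge0 ?nr_ge0.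
  have z_ge0 := nr_ge0 z; have fz0 := nr_ge0 (f z : R[i]).
  pose C := L * (1 + eta * (nr z + 1) ^+ 2)
            + nr (f z : R[i]) * (eta * (2 * nr z + 1)) + 1.
  have C0 : 0 < C.
    have t1 : 0 <= L * (1 + eta * (nr z + 1) ^+ 2).
      apply: mulr_ge0 => //; apply: addr_ge0 => //.
      by apply: mulr_ge0; [exact: ltW | exact: sqr_ge0].
    have t2 : 0 <= nr (f z : R[i]) * (eta * (2 * nr z + 1)).
      apply: mulr_ge0 => //; apply: mulr_ge0; [exact: ltW | lra].
    by rewrite /C; lra.
  exists (Num.min r1 (Num.min 1 (e / C))).
    by rewrite !lt_min r10 ltr01 divr_gt0.
  move=> w; rewrite !lt_min ltr_pdivlMr// => /and3P[w1 w2 w3].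
  have {}lip := lip w w1; have wz0 := nr_ge0 (w - z).
  have a1 : `|nr (f w : R[i]) - nr (f z : R[i])| <= L * nr (w - z).
    apply: le_trans lip; rewrite ler_norml; apply/andP; split.
      have := nrD (f w : R[i]) (f z - f w); rewrite addrC subrK (nr_distC (f z)); lra.
    have := nrD (f z : R[i]) (f w - f z); rewrite addrC subrK; lra.
  have a2 : nr w <= nr z + nr (w - z).
    by have := nrD z (w - z); rewrite addrC subrK; lra.
  have a3 : nr z <= nr w + nr (w - z).
    by have := nrD w (z - w); rewrite addrC subrK (nr_distC z); lra.
  have w_ge0 := nr_ge0 w.
  have a4 : `|nr w ^+ 2 - nr z ^+ 2| <= nr (w - z) * (2 * nr z + 1).
    rewrite ler_norml; apply/andP; split; nra.
  have a5 : nr w ^+ 2 <= (nr z + 1) ^+ 2.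
    by rewrite lerXn2r ?nnegrE//; lra.
  apply: le_lt_trans w3; rewrite /psi.
  rewrite (_ : _ - _ =
      (nr (f w : R[i]) - nr (f z : R[i])) * (1 + eta * nr w ^+ 2)
      + nr (f z : R[i]) * eta * (nr w ^+ 2 - nr z ^+ 2)); last by ring.
  apply: le_trans (ler_normD _ _) _.
  have p1 : 0 <= 1 + eta * nr w ^+ 2.
    by apply: addr_ge0 => //; apply: mulr_ge0; [exact: ltW | exact: sqr_ge0].
  have p2 : 0 <= nr (f z : R[i]) * eta by rewrite mulr_ge0// ltW.
  rewrite normrM (normrM (_ * eta)) (ger0_norm p1) (ger0_norm p2).
  apply: le_trans (_ : L * nr (w - z) * (1 + eta * (nr z + 1) ^+ 2)
      + nr (f z : R[i]) * eta * (nr (w - z) * (2 * nr z + 1)) <= _).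
    apply: lerD; last by rewrite ler_wpM2l.
    by rewrite ler_pM// lerD2l ler_wpM2l// ltW.
  by rewrite /C; lra.
have psi0 : nr (f z0 : R[i]) <= psi z0.
  by rewrite ler_peMr ?nr_ge0// lerDl mulr_ge0 ?(ltW eta0)// sqr_ge0.
have a_lt : nr a < r.
  rewrite lt_neqAle ar andbT; apply/eqP => ar_eq.
  have := amax z0 z0r; rewrite {2}/psi ar_eq; apply/negP; rewrite -ltNge.
  apply: lt_le_trans psi0; apply: le_lt_trans etaP.
  by rewrite ler_wpM2r ?fbd// addr_ge0// mulr_ge0 ?(ltW eta0)// sqr_ge0.
have fa0 : f a != 0.
  apply/eqP => fa0; have := amax z0 z0r; rewrite {2}/psi fa0 nr0 mul0r.
  by apply/negP; rewrite -ltNge; lra.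
pose B := 1 + eta * nr a ^+ 2.
have B1 : 1 <= B.
  by rewrite lerDl; apply: mulr_ge0; [exact: ltW | exact: sqr_ge0].
have B0 : 0 < B by lra.
pose w : R[i] := (eta / B)%:C * conjc a.
pose h := (r - nr a) / 2.
have h0 : 0 < h by rewrite /h; lra.
pose T := 1 + eta * r ^+ 2.
have T1 : 1 <= T.
  by rewrite lerDl; apply: mulr_ge0; [exact: ltW | exact: sqr_ge0].
pose d := eta * h ^+ 2 / B ^+ 2.
have d0 : 0 < d.
  by apply: divr_gt0; [apply: mulr_gt0 => //|]; exact: exprn_gt0.
pose theta := 1 - d / T.
have in_disc z : on_square a h z -> nr z <= r.
  move=> [h1 h2]; rewrite -(subrK a z); apply: le_trans (nrD _ _) _.
  have : nr (z - a) <= 2 * h.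
    by apply: le_trans (nr_le_ReIm _) _; rewrite mulr2n mulrDl !mul1r lerD.
  by rewrite /h; lra.
have dT : d <= T.
  rewrite /d ler_pdivrMr ?exprn_gt0//.
  have hr : h <= r by rewrite /h; have := nr_ge0 a; lra.
  have h2r2 : h ^+ 2 <= r ^+ 2 by apply: lerXn2r => //; rewrite nnegrE ltW.
  have B2 : 1 <= B ^+ 2 by rewrite exprn_ege1.
  apply: le_trans (_ : T <= _); last by rewrite ler_peMr//; lra.
  have : eta * h ^+ 2 <= eta * r ^+ 2 by rewrite ler_wpM2l// ltW.
  by rewrite /T; lra.
have th : 0 <= theta < 1.
  have T0 : 0 < T by lra.
  have dT0 : 0 < d / T by rewrite divr_gt0.
  have dT1 : d / T <= 1 by rewrite ler_pdivrMr// mul1r.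
  by rewrite /theta; apply/andP; split; lra.
apply: (@square_max (fun z => f z * (1 + w * (z - a)) ^+ 2 : R[i]^o) a h theta) => //.
- move=> z /in_disc zr; apply: cdiffM; first exact: fd.
  apply: cdiffX; apply: cdiffD; first exact: (@cdiff_cst _ R[i]^o).
  by apply: cdiffM; [exact: (@cdiff_cst _ R[i]^o) | exact: cdiff_sub].
- by rewrite subrr mulr0 addr0 expr1n mulr1.
- move=> z [sqz bdz].
  rewrite subrr mulr0 addr0 expr1n mulr1 (@nrM R) (@nrX R).
  have zr := in_disc _ sqz.
  pose q := (1 + eta * nr z ^+ 2) / B.
  have wE : nr (1 + w * (z - a)) ^+ 2 = q - eta * nr (z - a) ^+ 2 / B ^+ 2.
    rewrite /q /w /B !nr_sqr; have := B0; rewrite /B nr_sqr.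
    move: (a) (z) => [a1 a2] [z1 z2] /= B0'; field.
    by rewrite gt_eqF.
  have hz : h ^+ 2 <= nr (z - a) ^+ 2.
    have := Re_le_nr (z - a); have := Im_le_nr (z - a) => i1 i2.
    by rewrite lerXn2r ?nnegrE ?nr_ge0 ?(ltW h0)//; case: bdz => <-.
  have q0 : 0 < q.
    by rewrite divr_gt0// ltr_wpDr// mulr_ge0 ?(ltW eta0)// sqr_ge0.
  have qT : q <= T.
    rewrite ler_pdivrMr//; apply: le_trans (_ : T <= _); last by rewrite ler_peMr//; lra.
    rewrite lerD2l ler_wpM2l ?(ltW eta0)// lerXn2r ?nnegrE ?nr_ge0//.
    exact: ltW.
  have le1 : nr (1 + w * (z - a)) ^+ 2 <= theta * q.
    rewrite wE /theta mulrBl mul1r lerD2l lerN2.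
    apply: le_trans (_ : d <= _).
      by rewrite mulrAC ler_pdivrMr ?ler_wpM2l ?(ltW d0)//; lra.
    by rewrite ler_wpM2r ?invr_ge0 ?exprn_ge0 ?(ltW B0)// ler_wpM2l// ltW.
  apply: le_trans (_ : nr (f z : R[i]) * (theta * q) <= _).
    by rewrite ler_wpM2l ?nr_ge0.
  rewrite mulrCA ler_wpM2l//; first by case/andP: th.
  by rewrite /q mulrA ler_pdivrMr//; exact: amax.
Qed.
End MaximumPrinciple.

(** * The Schwarz lemma *)

Section Schwarz.
Context {R : realType}.

Lemma expr_gap (F x y : R) : 0 <= F < y -> 0 < x ->
  exists m, F ^+ m.+1 < x * y ^+ m.
Proof.
move=> /andP[F0 Fy] x0; have y0 : 0 < y by lra.
have th : `|F / y| < 1.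
  by rewrite ger0_norm ?divr_ge0 ?ltr_pdivrMr ?mul1r// ltW.
have F1 : 0 < F + 1 by lra.
have /cvgrPdist_le/(_ (x / (F + 1))) := cvg_expr th.
case; first by rewrite divr_gt0.
move=> m _ /(_ m (leqnn m)); rewrite sub0r normrN => hm; exists m.
have {hm} := le_trans (ler_norm _) hm.
rewrite expr_div_n ler_pdivrMr ?exprn_gt0// => hm.
have ym : 0 < y ^+ m by rewrite exprn_gt0.
rewrite exprS; apply: le_lt_trans (ler_wpM2l F0 hm) _.
rewrite (_ : F * _ = F / (F + 1) * (x * y ^+ m)); last by field; rewrite gt_eqF.
by rewrite gtr_pMl ?mulr_gt0// ltr_pdivrMr//; lra.
Qed.

(** The maximum principle is applied to [f ^ (m + 1) / z ^ m], which is
    differentiable also at the origin: on the circle of radius [r] it is at most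
    [F ^ (m + 1) / r ^ m], and letting [m] grow gives
    [r |f 1| <= F] for every [r < rho]. *)
Lemma schwarz (f : R[i] -> R[i]^o) (rho F : R) : 1 < rho ->
  (forall z, nr z < rho -> cdiff f z) -> f 0 = 0 ->
  (forall z, nr z < rho -> nr (f z : R[i]) <= F) ->
  rho * nr (f 1 : R[i]) <= F.
Proof.
move=> rho1 fd f0 fF; rewrite leNgt; apply/negP => Fx.
set x := nr (f 1 : R[i]) in Fx.
have F0 : 0 <= F by apply: le_trans (fF 0 _); rewrite ?nr_ge0// nr0; lra.
have x0 : 0 < x by rewrite -(@pmulr_rgt0 _ rho)//; lra.
have [r /andP[r1 rrho] Fr] : exists2 r, 1 < r < rho & F < r * x.
  have Frho : F / x < rho by rewrite ltr_pdivrMr.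
  exists ((Num.max 1 (F / x) + rho) / 2).
    have : 1 <= Num.max 1 (F / x) by rewrite le_max lexx.
    have : Num.max 1 (F / x) < rho by rewrite gt_max rho1.
    by move=> ? ?; apply/andP; split; lra.
  rewrite -ltr_pdivrMr//.
  have : F / x <= Num.max 1 (F / x) by rewrite le_max lexx orbT.
  lra.
pose E m := iter m (fun (g : R[i] -> R[i]^o) z => g z * f z / (z - 0) : R[i]^o) f.
have Ed m z : nr z < rho -> cdiff (E m) z.
  move=> zr; elim: m => [|m IH]; first exact: fd.
  apply: cdiff_muldiv => //; last exact: fd.
  by case: (m) => [//|n] /=; rewrite f0 mulr0 mul0r.
have EnE m z : z != 0 -> nr (E m z : R[i]) = nr (f z : R[i]) ^+ m.+1 / nr z ^+ m.
  move=> z0; elim: m => [|m IH]; first by rewrite expr1 expr0 divr1.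
  rewrite [E m.+1 z]/(E m z * f z / (z - 0)) subr0 (@nrM R) (@nrM R) (@nrV R) IH.
  have nz : nr z != 0 by rewrite gt_eqF// nr_gt0.
  by rewrite !exprS; field; rewrite ?expf_neq0 ?nz.
have [m] := @expr_gap F x (r * x) ltac:(by rewrite F0 Fr) x0.
apply/negP; rewrite -leNgt.
have r0 : 0 < r by lra.
have : nr (E m 1 : R[i]) <= F ^+ m.+1 / r ^+ m; first apply: (disc_max r0).
- by move=> z zr; apply: Ed; exact: le_lt_trans rrho.
- move=> z zr; have z0 : z != 0.
    by apply/eqP => z0; rewrite z0 nr0 in zr; lra.
  rewrite EnE// zr ler_wpM2r ?invr_ge0 ?exprn_ge0 ?(ltW r0)//.
  by rewrite lerXn2r ?nnegrE ?nr_ge0 ?fF// zr.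
- by rewrite nr1 ltW.
rewrite EnE ?oner_eq0// nr1 expr1n divr1 ler_pdivlMr ?exprn_gt0//.
by rewrite -/x exprMn exprS mulrAC mulrA.
Qed.
End Schwarz.

(** * Inner products, adjoints and inverses *)

Section HermitianForms.
Context {R : realType}.

(** Degenerate forms are included: the lemma below is also used for the defect
    forms of contractions. *)
Definition psd_form (E : lmodType R[i]) (B : E -> E -> R[i]) :=
  [/\ forall k x y z, B (k *: x + y) z = k * B x z + B y z,
      forall x y, B y x = conjc (B x y) &
      forall x, 0 <= complex.Re (B x x)].

Lemma psd_cauchy_schwarz (E : lmodType R[i]) (B : E -> E -> R[i]) x y :
  psd_form B -> nr (B x y) ^+ 2 <= complex.Re (B x x) * complex.Re (B y y).
Proof.
move=> [Bl Bc Bp].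
have Br k u v w : B w (k *: u + v) = conjc k * B w u + B w v.
  by rewrite Bc Bl rmorphD rmorphM /= -!Bc.
set c := B x y.
have key (t : R) : 0 <= complex.Re (B x x) - 2 * t * nr c ^+ 2
    + t ^+ 2 * nr c ^+ 2 * complex.Re (B y y).
  have := Bp ((- (t%:C * c)) *: y + x).
  rewrite Bl !Br (Bc x y) -/c nr_sqr.
  have yreal : complex.Im (B y y) = 0.
    by have := Bc y y; case: (B y y) => a b /= [] ?; lra.
  move: yreal; case: (B y y) => b1 b2 /= ->; case: (B x x) => a1 a2.
  case: (c) => c1 c2 /= h.
  by apply: le_trans h _; rewrite le_eqVlt; apply/orP; left; apply/eqP; ring.
set a := complex.Re (B x x) in key *; set b := complex.Re (B y y) in key *.
set s := nr c ^+ 2 in key *.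
have a0 : 0 <= a := Bp x; have b0 : 0 <= b := Bp y.
have s0 : 0 <= s by rewrite sqr_ge0.
clearbody a b s.
have [b_gt0|b_le0] := ltP 0 b.
  have := key b^-1; rewrite -(ler_pM2r b_gt0) mul0r.
  rewrite (_ : (a - _ + _) * b = a * b - s); last by field; rewrite gt_eqF.
  by rewrite subr_ge0.
have b_eq0 : b = 0 by lra.
rewrite b_eq0 mulr0 leNgt; apply/negP => s_gt0.
have := key ((a + 1) / (2 * s)); rewrite b_eq0 mulr0 addr0.
rewrite (_ : a - _ = -1); first by lra.
by field; rewrite gt_eqF.
Qed.
End HermitianForms.

Section HilbertSpace.
Context {R : realType} {E : hilbertType R[i]}.
Implicit Types x y z : E.

Lemma dotDl x y z : hdot (x + y) z = hdot x z + hdot y z.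
Proof. by rewrite linearDl. Qed.

Lemma dotZl a x z : hdot (a *: x) z = a * hdot x z.
Proof. by rewrite linearZl_LR. Qed.

Lemma dotC x y : hdot y x = conjc (hdot x y).
Proof. by rewrite hermC /= expr0 mul1r. Qed.

Lemma dotDr x y z : hdot z (x + y) = hdot z x + hdot z y.
Proof. by rewrite linearDr. Qed.

Lemma dotZr a x z : hdot z (a *: x) = conjc a * hdot z x.
Proof. by rewrite linearZr_LR. Qed.

Lemma dotNr x z : hdot z (- x) = - hdot z x.
Proof. by rewrite linearNr. Qed.

Lemma dotBl x y z : hdot (x - y) z = hdot x z - hdot y z.
Proof. by rewrite linearBl. Qed.

Lemma dotBr x y z : hdot z (x - y) = hdot z x - hdot z y.
Proof. by rewrite linearBr. Qed.

Lemma dot0l z : hdot 0 z = 0.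
Proof. by rewrite linear0l. Qed.

Lemma dot0r z : hdot z 0 = 0.
Proof. by rewrite linear0r. Qed.

Lemma dot_suml n (v : 'I_n -> E) z :
  hdot (\sum_i v i) z = \sum_i hdot (v i) z.
Proof. by apply: (big_morph (fun x => hdot x z)) => [x y|] /=; rewrite ?dotDl ?dot0l. Qed.

Lemma dot_sumr n (v : 'I_n -> E) z :
  hdot z (\sum_i v i) = \sum_i hdot z (v i).
Proof. by apply: (big_morph (fun x => hdot z x)) => [x y|] /=; rewrite ?dotDr ?dot0r. Qed.

Lemma dot_nr x : hdot x x = (nr x ^+ 2)%:C.
Proof. by rewrite hdot_norm -nrE rmorphXn. Qed.

Lemma Re_dot_nr x : complex.Re (hdot x x) = nr x ^+ 2.
Proof. by rewrite dot_nr. Qed.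

Lemma Re_dotC x y : complex.Re (hdot y x) = complex.Re (hdot x y).
Proof. by rewrite dotC; case: (hdot x y). Qed.

Lemma nr_sqrD x y :
  nr (x + y) ^+ 2 = nr x ^+ 2 + nr y ^+ 2 + 2 * complex.Re (hdot x y).
Proof.
rewrite -!Re_dot_nr dotDl !dotDr.
have := Re_dotC x y.
case: (hdot x x) => ? ?; case: (hdot x y) => ? ?; case: (hdot y x) => ? ?.
case: (hdot y y) => ? ? /= ->; ring.
Qed.

Lemma nr_sqrB x y :
  nr (x - y) ^+ 2 = nr x ^+ 2 + nr y ^+ 2 - 2 * complex.Re (hdot x y).
Proof. by rewrite nr_sqrD nrN dotNr; case: (hdot x y) => ? ? /=; ring. Qed.

Lemma parallelogram x y :
  nr ((1 / 2)%:C *: (x + y)) ^+ 2 =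
  (nr x ^+ 2 + nr y ^+ 2) / 2 - nr (x - y) ^+ 2 / 4.
Proof.
rewrite nrZ nr_real gtr0_norm; last by lra.
by rewrite exprMn nr_sqrB nr_sqrD; field.
Qed.

Lemma cauchy_schwarz x y : nr (hdot x y) <= nr x * nr y.
Proof.
rewrite -(@ler_pXn2r _ 2) ?nnegrE ?mulr_ge0 ?nr_ge0// exprMn -!Re_dot_nr.
apply: (@psd_cauchy_schwarz _ _ (fun u v : E => hdot u v)); split.
- by move=> k u v w; rewrite dotDl dotZl.
- by move=> u v; rewrite dotC.
- by move=> u; rewrite Re_dot_nr sqr_ge0.
Qed.

Lemma dot_eq0 x : (forall y, hdot y x = 0) -> x = 0.
Proof.
move=> /(_ x) h; apply: nr_eq0; apply/eqP.
by rewrite -sqrf_eq0 -Re_dot_nr h.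
Qed.

End HilbertSpace.

Section FiniteDimension.
Context {R : realType} {K : hilbertType R[i]}.
Hypothesis finK : finite_dimensional K.

Lemma coordinates : exists n (c : {linear K -> 'rV[R[i]]_n})
  (e : {linear 'rV[R[i]]_n -> K}), cancel c e /\ cancel e c.
Proof.
have [n [[c lin_c [e ceK ecK]]]] := finK.
have lin_e : linear e.
  by move=> a u v; apply: (can_inj ceK); rewrite lin_c !ecK.
pose cm := GRing.isLinear.Build _ _ _ _ c lin_c.
pose em := GRing.isLinear.Build _ _ _ _ e lin_e.
pose c' : {linear K -> 'rV[R[i]]_n} := HB.pack c cm.
pose e' : {linear 'rV[R[i]]_n -> K} := HB.pack e em.
exists n, c', e'; split; [exact: ceK | exact: ecK].
Qed.

(** In coordinates [A] is a square matrix with trivial kernel. *)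
Lemma lin_inverse (A : K -> K) : linear A -> (forall x, A x = 0 -> x = 0) ->
  exists B : K -> K, [/\ linear B, forall x, A (B x) = x & forall x, B (A x) = x].
Proof.
move=> lin_A injA.
have [n [c [e [ceK ecK]]]] := coordinates.
pose Am := GRing.isLinear.Build _ _ _ _ A lin_A.
pose A' : {linear K -> K} := HB.pack A Am.
pose M := lin1_mx (c \o A' \o e).
have ME v : v *m M = c (A (e v)) by rewrite mul_rV_lin1.
have Mu : M \in unitmx.
  rewrite -row_free_unit; apply: inj_row_free => v; rewrite ME => h.
  apply: (can_inj ecK); rewrite linear0; apply: injA.
  by apply: (can_inj ceK); rewrite h linear0.
have injA2 x y : A x = A y -> x = y.
  move=> h; apply/eqP; rewrite -subr_eq0; apply/eqP; apply: injA.
  by rewrite -[A _]/(A' _) linearB /= h subrr.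
have AB x : A (e (c x *m invmx M)) = x.
  by apply: (can_inj ceK); rewrite -ME mulmxKV.
exists (fun x => e (c x *m invmx M)); split=> //.
  move=> a x y; apply: injA2.
  by rewrite lin_A !AB.
by move=> x; apply: injA2; rewrite AB.
Qed.

(** With respect to a basis of [K], finding the adjoint at [h] means solving a linear
    system whose matrix is the Gram matrix of the basis, invertible because the
    inner product is definite. *)
Lemma adjoint_exists (H : hilbertType R[i]) (X : {linear K -> H}) :
  exists Xs : {linear H -> K}, forall k h, hdot (X k) h = hdot k (Xs h).
Proof.
have [n [c [e [ceK ecK]]]] := coordinates.
pose b i := e (delta_mx 0 i).
have eE v : e v = \sum_i v 0 i *: b i.
  by rewrite {1}(row_sum_delta v) linear_sum; apply: eq_bigr => i _; rewrite linearZ.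
pose Gm : 'M[R[i]]_n := \matrix_(i, j) hdot (b i) (b j).
have Gu : Gm \in unitmx.
  rewrite -row_free_unit; apply: inj_row_free => v vG.
  apply: (can_inj ecK); rewrite linear0; apply: dot_eq0 => y.
  rewrite dotC -(ceK y) (eE (c y)) dot_sumr big1 ?conjc0// => j _.
  rewrite dotZr; suff -> : hdot (e v) (b j) = 0 by rewrite mulr0.
  rewrite eE dot_suml -[RHS](_ : (v *m Gm) 0 j = 0); last by rewrite vG mxE.
  by rewrite mxE; apply: eq_bigr => i _; rewrite dotZl mxE.
have ex h : exists y, forall k, hdot (X k) h = hdot k y.
  pose w : 'cV[R[i]]_n := invmx Gm *m \col_i hdot (X (b i)) h.
  exists (e (\row_j conjc (w j 0))) => k.
  have base i : hdot (X (b i)) h = hdot (b i) (e (\row_j conjc (w j 0))).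
    rewrite eE dot_sumr.
    have : (Gm *m w) i 0 = hdot (X (b i)) h by rewrite mulKVmx// mxE.
    move=> <-; rewrite mxE; apply: eq_bigr => j _.
    by rewrite [(\row__ _) _ _]mxE [Gm _ _]mxE dotZr conjcK mulrC.
  rewrite -(ceK k) (eE (c k)) linear_sum !dot_suml; apply: eq_bigr => i _.
  by rewrite linearZ !dotZl base.
have [Xs XsE] := choice ex.
have lin_Xs : linear Xs.
  move=> a u v; apply/eqP; rewrite -subr_eq0; apply/eqP; apply: dot_eq0 => k.
  by rewrite dotBr -XsE dotDr dotZr !XsE dotDr dotZr subrr.
pose Xm := GRing.isLinear.Build _ _ _ _ Xs lin_Xs.
pose Xs' : {linear H -> K} := HB.pack Xs Xm.
by exists Xs' => k h; exact: XsE.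
Qed.

End FiniteDimension.

(** * A compact set of directions *)

Section CompactSphere.
Context {R : realType} {K : hilbertType R[i]}.
Hypothesis finK : finite_dimensional K.

(** The image of the unit sphere of a real coordinate space: it plays the role of the
    unit sphere of [K] without any comparison of norms. *)
Lemma compact_sphere : exists2 S : set K, compact S &
  ~ S 0 /\ forall k, k != 0 -> exists a : R[i], S (a *: k).
Proof.
have [n [c [e [ceK ecK]]]] := coordinates finK.
(* The n complex coordinates are given by 2n real ones, for which closed bounded
   sets are compact. *)
pose row (x : 'rV[R]_(n + n)) : 'rV[R[i]]_n :=
  \row_j (x 0 (lshift n j) +i* x 0 (rshift n j)).
pose Psi x := e (row x).
pose C := \sum_j 2 * nr (e (delta_mx 0 j)).
have C0 : 0 <= C by apply: sumr_ge0 => j _; rewrite mulr_ge0 ?nr_ge0.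
have coord_le (x : 'rV[R]_(n + n)) j : `|x 0 j| <= `|x|.
  rewrite [in leRHS]/Num.Def.normr /= mx_normrE.
  by apply: le_trans (le_bigmax _ _ (0, j)).
have PsiC x : nr (Psi x) <= C * `|x|.
  rewrite /Psi (row_sum_delta (row x)) linear_sum /C mulr_suml.
  apply: (big_ind2 (fun (u : K) (v : R) => nr u <= v)); first by rewrite nr0.
    by move=> u1 v1 u2 v2 h1 h2; apply: le_trans (nrD _ _) _; rewrite lerD.
  move=> j _; rewrite linearZ nrZ mulrAC ler_wpM2r ?nr_ge0//.
  rewrite mxE; apply: le_trans (nr_le_ReIm _) _ => /=.
  by rewrite mulr2n mulrDl !mul1r lerD.
have PsiB x y : Psi x - Psi y = Psi (x - y).
  rewrite /Psi -linearB; congr (e _); apply/rowP => j; rewrite !mxE.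
  by apply/eqP; rewrite eq_complex /= !eqxx.
have cont : continuous Psi.
  move=> x; apply/(@cvgrPdist_lt _ K _ _ (nbhs_filter x)) => eps eps0.
  have [epsE r0] := Re_gt0 eps0.
  have d0 : 0 < complex.Re eps / (C + 1) by rewrite divr_gt0// ltr_wpDl.
  have := nbhsx_ballx x _ d0.
  apply: (@filterS _ _ (nbhs_filter x)) => y; rewrite -ball_normE /= => xy.
  rewrite PsiB -nrE -epsE ltcR; apply: le_lt_trans (PsiC _) _.
  rewrite ltr_pdivlMr in xy; last by rewrite ltr_wpDl.
  by have := normr_ge0 (x - y); nra.
exists (Psi @` [set x | `|x| = 1]).
  apply: continuous_compact; first exact: continuous_subspaceT.
  apply: bounded_closed_compact.
    by exists 1; split => // M M1 x /= ->; exact: ltW.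
  rewrite (_ : [set x | _] = Num.norm @^-1` [set 1 : R]); last by [].
  apply: closed_comp; last exact: closed_eq.
  by move=> x _; exact: norm_continuous.
have inj x : Psi x = 0 -> x = 0.
  move=> /(congr1 c); rewrite ecK linear0 => /rowP rx.
  apply/rowP => j; rewrite mxE; case: (splitP j) => i ji.
    have := rx i; rewrite !mxE => /(congr1 (@complex.Re R)) /= <-.
    by congr (x 0 _); apply: val_inj.
  have := rx i; rewrite !mxE => /(congr1 (@complex.Im R)) /= <-.
  by congr (x 0 _); apply: val_inj.
split.
  by move=> [x /= x1 /inj x0]; move: x1; rewrite x0 normr0; lra.
move=> k k0.
pose x : 'rV[R]_(n + n) := row_mx (\row_j complex.Re (c k 0 j)) (\row_j complex.Im (c k 0 j)).
have xk : Psi x = k.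
  rewrite -[RHS]ceK; congr (e _); apply/rowP => j.
  rewrite mxE row_mxEl row_mxEr !mxE.
  by case: (c k 0 j).
have x0 : 0 < `|x|.
  rewrite normr_gt0; apply: contra_neq k0 => x0.
  by apply: nr_eq0; apply/eqP; rewrite eq_le nr_ge0 andbT -xk
    (le_trans (PsiC _))// x0 normr0 mulr0.
exists (`|x|^-1)%:C; exists (`|x|^-1 *: x).
  by rewrite /= normrZ normfV normr_id mulVf// gt_eqF.
rewrite -[in RHS]xk /Psi -linearZ; congr (e _); apply/rowP => j; rewrite !mxE.
by apply/eqP; rewrite eq_complex /= !mul0r subr0 addr0 !eqxx.
Qed.

End CompactSphere.

(** * The hyperbolic distance of two contractions *)

Section Operators.
Context {R : realType} {H K : hilbertType R[i]}.
Implicit Types (X Y : 'L(K, H)) (u v p : K).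

Lemma nr_app X u : nr (X u) <= nr X * nr u.
Proof. by rewrite -lecR rmorphM /= !nrE bop_normE; exact: opnormP. Qed.

Lemma nr_op_le X (M : R) : 0 <= M -> (forall u, nr (X u) <= M * nr u) -> nr X <= M.
Proof.
move=> M0 XM; apply: opnorm_le => // u.
by rewrite -!nrE -rmorphM lecR.
Qed.

Lemma op_of_linear (f : K -> H) (M : R) : linear f ->
  (forall u, nr (f u) <= M * nr u) -> exists X : 'L(K, H), forall u, X u = f u.
Proof.
move=> lin_f fM.
have fP : f \in @bounded_operator R K H.
  apply/bounded_operatorP; split => //; exists M%:C => u.
  by rewrite -!nrE -rmorphM lecR.
by exists (BoundedOp fP).
Qed.

Lemma op_eq X Y : (forall u, X u = Y u) -> X = Y.
Proof. by move=> XY; apply/val_inj/funext. Qed.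

(** Linearity stated with the coercion of operators to functions; [lmod] compares
    vectors syntactically. *)
Lemma app_linear X a u v : X (a *: u + v) = a *: X u + X v. Proof. exact: linearP. Qed.
Lemma appD X u v : X (u + v) = X u + X v. Proof. exact: linearD. Qed.
Lemma appB X u v : X (u - v) = X u - X v. Proof. exact: linearB. Qed.
Lemma appZ X a u : X (a *: u) = a *: X u. Proof. exact: linearZ. Qed.
Lemma linD (f : {linear H -> K}) h h' : f (h + h') = f h + f h'.
Proof. exact: linearD. Qed.
Lemma linB (f : {linear H -> K}) h h' : f (h - h') = f h - f h'.
Proof. exact: linearB. Qed.
Lemma linZ (f : {linear H -> K}) a h : f (a *: h) = a *: f h.
Proof. exact: linearZ. Qed.
Lemma opDE X Y u : (X + Y) u = X u + Y u. Proof. by []. Qed.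
Lemma opNE X u : (- X) u = - X u. Proof. by []. Qed.

Lemma cdiff_dot (f : R[i] -> H) (b : H) z :
  cdiff f z -> cdiff (fun w => hdot (f w) b : R[i]^o) z.
Proof.
move=> [d fd]; exists (hdot d b) => e e0.
have b1 : 0 < nr b + 1 by have := nr_ge0 b; lra.
have [r r0 {}fd] := fd (e / (nr b + 1)) ltac:(by rewrite divr_gt0).
exists r => // w wr.
have -> : hdot (f w) b - hdot (f z) b - (w - z) *: (hdot d b : R[i]^o) =
    hdot (f w - f z - (w - z) *: d) b by rewrite !dotBl dotZl.
apply: le_trans (cauchy_schwarz _ _) _.
have := fd w wr; set t := nr (_ - _) => h.
apply: le_trans (ler_wpM2r (nr_ge0 b) h) _.
rewrite [leRHS](_ : _ = e / (nr b + 1) * nr (w - z) * (nr b + 1)); last first.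
  by field; rewrite gt_eqF.
apply: ler_wpM2l; last by rewrite lerDl.
by rewrite mulr_ge0 ?nr_ge0// ltW// divr_gt0.
Qed.

(** The value of the indefinite form [|k| ^ 2 - |h| ^ 2] of the direct sum of [K] and
    [H] at the point of the graph of [X] above [u]. *)
Definition defect X u : R := nr u ^+ 2 - nr (X u) ^+ 2.

Definition defect_form X u v : R[i] := hdot u v - hdot (X u) (X v).

Lemma Re_defect_form X u : complex.Re (defect_form X u u) = defect X u.
Proof. by rewrite /defect_form !dot_nr. Qed.

Lemma defect_ge X (r : R) u : nr X <= r -> (1 - r ^+ 2) * nr u ^+ 2 <= defect X u.
Proof.
move=> Xr; have := nr_app X u; have := nr_ge0 (X u); have := nr_ge0 u.
have := nr_ge0 X; rewrite /defect => X0 u0 Xu0 h.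
have : nr (X u) <= r * nr u by apply: le_trans h _; rewrite ler_wpM2r.
nra.
Qed.

Lemma defect_ge0 X u : nr X <= 1 -> 0 <= defect X u.
Proof. by move=> X1; have := defect_ge u X1; rewrite expr1n subrr mul0r. Qed.

Lemma defect_le X u : defect X u <= nr u ^+ 2.
Proof. by rewrite /defect gerBl sqr_ge0. Qed.

Lemma defect_cauchy_schwarz X u v : nr X <= 1 ->
  nr (defect_form X u v) ^+ 2 <= defect X u * defect X v.
Proof.
move=> X1; rewrite -!Re_defect_form.
apply: (@psd_cauchy_schwarz _ _ (defect_form X)); split.
- move=> k x y z; rewrite /defect_form app_linear !dotDl !dotZl; ring.
- move=> x y; by rewrite /defect_form (dotC x) (dotC (X x)) rmorphB.
- by move=> x; rewrite Re_defect_form defect_ge0.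
Qed.

(** A reverse Cauchy-Schwarz inequality between the graphs of [X] and [Y], which are
    positive subspaces for the indefinite form of the direct sum of [K] and [H]. The
    least such [c] is the square of the hyperbolic cosine of the Caratheodory
    distance of [X] and [Y] in the unit ball. In this form no inverse or square
    root of an operator occurs, and for fixed [X], [u] and [a] the condition is
    convex in the vector [Y u]. *)
Definition cosh2_le (c : R) X Y := forall u a,
  nr (hdot u a - hdot (Y u) (X a)) ^+ 2 <= c * defect Y u * defect X a.

End Operators.

Section Adjoint.
Context {R : realType} {H K : hilbertType R[i]}.
Variables (X : 'L(K, H)) (Xs : {linear H -> K}).
Hypothesis XsE : forall k h, hdot (X k) h = hdot k (Xs h).

Lemma nr_adjoint h : nr (Xs h) <= nr X * nr h.
Proof.
have := cauchy_schwarz (X (Xs h)) h; rewrite XsE dot_nr nr_real ger0_norm ?sqr_ge0//.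
have := nr_app X (Xs h); have := nr_ge0 (Xs h); have := nr_ge0 h => h0 x0 h1 h2.
have h3 : nr (Xs h) ^+ 2 <= nr X * nr (Xs h) * nr h.
  by apply: le_trans h2 _; rewrite ler_wpM2r.
have [x_gt0|x_le0] := ltP 0 (nr (Xs h)).
  by rewrite -(ler_pM2l x_gt0); apply: le_trans h3 _; rewrite mulrA (mulrC (nr X)).
by apply: le_trans x_le0 _; rewrite mulr_ge0 ?nr_ge0.
Qed.

(** Opposite of the value of the indefinite form at [(Xs n, n)]; these vectors form
    the orthogonal complement of the graph of [X]. *)
Definition codefect n : R := nr n ^+ 2 - nr (Xs n) ^+ 2.

Definition codefect_form n b : R[i] := hdot n b - hdot (Xs n) (Xs b).

Lemma Re_codefect_form n : complex.Re (codefect_form n n) = codefect n.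
Proof. by rewrite /codefect_form !dot_nr. Qed.

Lemma codefect_ge (r : R) n : nr X <= r -> (1 - r ^+ 2) * nr n ^+ 2 <= codefect n.
Proof.
move=> Xr; have := nr_adjoint n; have := nr_ge0 (Xs n); have := nr_ge0 n.
have := nr_ge0 X; rewrite /codefect => X0 u0 Xu0 h.
have : nr (Xs n) <= r * nr n by apply: le_trans h _; rewrite ler_wpM2r.
nra.
Qed.

Lemma codefect_ge0 n : nr X <= 1 -> 0 <= codefect n.
Proof. by move=> X1; have := codefect_ge n X1; rewrite expr1n subrr mul0r. Qed.

Lemma codefect_cauchy_schwarz n b : nr X <= 1 ->
  nr (codefect_form n b) ^+ 2 <= codefect n * codefect b.
Proof.
move=> X1; rewrite -!Re_codefect_form.
apply: (@psd_cauchy_schwarz _ _ codefect_form); split.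
- move=> k x y z; rewrite /codefect_form [Xs (_ *: _ + _)]linearP !dotDl !dotZl; ring.
- move=> x y; by rewrite /codefect_form (dotC x) (dotC (Xs x)) rmorphB.
- by move=> x; rewrite Re_codefect_form codefect_ge0.
Qed.

Lemma codefectZ a n : codefect (a *: n) = nr a ^+ 2 * codefect n.
Proof. by rewrite /codefect (linZ Xs) !nrZ !exprMn mulrBr. Qed.

(** The vector [(p, X p)] of the graph of [X] and the vector [(Xs n, n)] are orthogonal
    for the indefinite form. *)
Lemma krein_pythagoras p n :
  nr (p + Xs n) ^+ 2 - nr (X p + n) ^+ 2 = defect X p - codefect n.
Proof. by rewrite !nr_sqrD XsE /defect /codefect; ring. Qed.

Lemma one_sub_adjoint_inj (Y : 'L(K, H)) u : nr X < 1 -> nr Y <= 1 ->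
  u - Xs (Y u) = 0 -> u = 0.
Proof.
move=> X1 Y1 /eqP; rewrite subr_eq0 => /eqP uE; apply: nr_eq0.
have := nr_adjoint (Y u); rewrite -uE => h1.
have h2 := nr_app Y u; have u0 := nr_ge0 u; have X0 := nr_ge0 X.
have : nr Y * nr u <= nr u by rewrite ler_piMl.
nra.
Qed.

Lemma one_sub_adjoint_bound (Y : 'L(K, H)) u : nr Y <= 1 ->
  (1 - nr X) * nr u <= nr (u - Xs (Y u)).
Proof.
move=> Y1; have := nrD (u - Xs (Y u)) (Xs (Y u)); rewrite subrK.
have h1 := nr_adjoint (Y u); have h2 := nr_app Y u.
have u0 := nr_ge0 u; have X0 := nr_ge0 X.
have : nr Y * nr u <= nr u by rewrite ler_piMl.
nra.
Qed.

End Adjoint.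

(** * The Schwarz-Pick lemma for operator-valued functions *)

Section SchwarzPickOperators.
Context {R : realType} {H K : hilbertType R[i]}.
Hypothesis finK : finite_dimensional K.
Implicit Types (X Y : 'L(K, H)) (u v p : K).

Lemma one_sub_adjoint_inverse X (Xs : {linear H -> K}) Y :
  (forall k h, hdot (X k) h = hdot k (Xs h)) -> nr X < 1 -> nr Y <= 1 ->
  exists B : K -> K, [/\ linear B, forall x, B x - Xs (Y (B x)) = x &
    forall x, B (x - Xs (Y x)) = x].
Proof.
move=> XsE X1 Y1; apply: (@lin_inverse _ _ finK (fun x => x - Xs (Y x))).
  by move=> a x y; rewrite (app_linear Y) (linD Xs) (linZ Xs); lmod.
by move=> x; exact: one_sub_adjoint_inj.
Qed.

(** With [w] and [v] the values at two points of a solution of the equation, [h] the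
    increment of the variable and [d] the candidate for the derivative, this
    expresses the remainder through that of the coefficient of the equation. *)
Lemma perturbed_solution (Xs : {linear H -> K}) (V W W' : 'L(K, H))
    (h : R[i]) (v w d a : K) :
  v - Xs (V v) = a -> w - Xs (W w) = a -> d - Xs (W d) = Xs (W' w) ->
  v - w - h *: d - Xs (V (v - w - h *: d)) =
  Xs ((V - W - h *: W') w + h *: (V - W) d).
Proof.
move=> va wa dw.
have {}va : Xs (V v) = v - a by rewrite -va opprB addrC subrK.
have {}wa : Xs (W w) = w - a by rewrite -wa opprB addrC subrK.
have -> : Xs (V (v - w - h *: d)) = Xs (V v) - Xs (V w) - h *: Xs (V d).
  by rewrite !(appB V) (appZ V) !(linB Xs) (linZ Xs).
have -> : Xs ((V - W - h *: W') w + h *: (V - W) d) =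
    Xs (V w) - Xs (W w) - h *: Xs (W' w) + h *: (Xs (V d) - Xs (W d)).
  rewrite [X in Xs X](_ : _ = V w - W w - h *: W' w + h *: (V d - W d))//.
  by rewrite (linD Xs) !(linB Xs) !(linZ Xs) (linB Xs).
by rewrite va wa -dw; lmod.
Qed.

Lemma op_adjoint X : exists Xs : {linear H -> K},
  forall k h, hdot (X k) h = hdot k (Xs h).
Proof. exact: (adjoint_exists finK X). Qed.

Lemma cdiff_resolvent X (Xs : {linear H -> K}) (W : R[i] -> 'L(K, H))
    (U : R[i] -> K) (a : K) (z : R[i]) (rho : R) :
  (forall k h, hdot (X k) h = hdot k (Xs h)) -> nr X < 1 -> 0 < rho ->
  (forall w, nr (w - z) < rho ->
    nr (W w) <= 1 /\ U w - Xs (W w (U w)) = a) ->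
  cdiff W z -> cdiff U z.
Proof.
move=> XsE X1 rho0 WU [W' Wd].
have [Wz1 Uz] : nr (W z) <= 1 /\ U z - Xs (W z (U z)) = a.
  by apply: WU; rewrite subrr nr0.
have [B [_ Bl _]] := one_sub_adjoint_inverse XsE X1 Wz1.
pose d := B (Xs (W' (U z))).
have dE : d - Xs (W z d) = Xs (W' (U z)) by rewrite Bl.
exists d => e e0.
pose q := 1 - nr X; have q0 : 0 < q by rewrite subr_gt0.
have W'1 : 0 < nr W' + 1 by rewrite ltr_wpDl ?nr_ge0.
have Uz1 : 0 < nr (U z) + 1 by rewrite ltr_wpDl ?nr_ge0.
have d1 : 0 < nr d + 1 by rewrite ltr_wpDl ?nr_ge0.
pose e1 := e * q / 2 / (nr (U z) + 1).
have e10 : 0 < e1 by rewrite divr_gt0// divr_gt0// mulr_gt0.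
pose C := (nr W' + 1) * (nr d + 1); have C0 : 0 < C by rewrite mulr_gt0.
have [r1 r10 h1] := Wd e1 e10; have [r2 r20 h2] := cderiv_lip Wd.
exists (Num.min rho (Num.min (Num.min r1 r2) (e * q / 2 / C))).
  rewrite !lt_min r10 r20 rho0 /=; apply: divr_gt0 => //.
  by rewrite divr_gt0// mulr_gt0.
move=> w; rewrite !lt_min => /and3P[w1 /andP[w2 w3] w4].
have [Ww1 Uw] := WU w w1.
have {}h1 := h1 w w2; have {}h2 := h2 w w3; set h := w - z in h1 h2 w4 *.
have := one_sub_adjoint_bound XsE (U w - U z - h *: d) Ww1.
rewrite (perturbed_solution h Uw Uz dE) -/q => le1.
set v := (_ + _ : H) in le1.
have le2 : nr (Xs v) <= nr v.
  apply: le_trans (nr_adjoint XsE v) _.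
  by rewrite ler_piMl ?nr_ge0// ltW.
have le3 : nr v <= e1 * nr h * nr (U z) + nr h * ((nr W' + 1) * nr h * nr d).
  apply: le_trans (nrD _ _) _; apply: lerD.
    by apply: le_trans (nr_app _ _) _; rewrite ler_wpM2r ?nr_ge0.
  rewrite nrZ ler_wpM2l ?nr_ge0//; apply: le_trans (nr_app _ _) _.
  by rewrite ler_wpM2r ?nr_ge0.
have k1 : e1 * nr h * nr (U z) <= e * q / 2 * nr h.
  rewrite mulrAC ler_wpM2r ?nr_ge0// /e1 mulrAC ler_pdivrMr//.
  apply: ler_wpM2l; last by rewrite lerDl.
  by rewrite divr_ge0// mulr_ge0 ?(ltW e0)// ltW.
have k2 : nr h * ((nr W' + 1) * nr h * nr d) <= e * q / 2 * nr h.
  rewrite mulrC ler_wpM2r ?nr_ge0//; rewrite ltr_pdivlMr// in w4.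
  apply: le_trans (ltW w4); rewrite /C (mulrAC _ (nr h)) mulrC.
  apply: ler_wpM2l; first exact: nr_ge0.
  by apply: ler_wpM2l; [exact: ltW | rewrite lerDl].
rewrite -(ler_pM2l q0); move: le1 le2 le3 k1 k2; clear; lra.
Qed.

(** Split the graph vector [(U z, W z (U z))] along the graph of [X = W 0] and its
    orthogonal complement, with components [(p, X p)] and [(Xs (n z), n z)], choosing
    [U z] so that [p] does not depend on [z]. As the graph of [W z] is positive,
    [codefect (n z) <= defect p], and this bounds the holomorphic function
    [z |-> <n z, b> - <Xs (n z), Xs b>], which vanishes at 0. The Schwarz lemma with
    [b = n 1] gives [rho ^ 2 * codefect b <= defect p], that is
    [defect p <= c * defect u], and [defect_cauchy_schwarz] does the rest. *)
Lemma schwarz_pick (W : R[i] -> 'L(K, H)) (c rho : R) :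
  1 < c -> 1 < rho -> rho ^+ 2 = c / (c - 1) ->
  (forall z, nr z < rho -> cdiff W z /\ nr (W z) < 1) ->
  cosh2_le c (W 0) (W 1).
Proof.
move=> c1 rho1 rhoE WP u a'.
have n0 : nr (0 : R[i]) < rho by rewrite nr0; lra.
have n1 : nr (1 : R[i]) < rho by rewrite nr1.
set X := W 0; have X1 : nr X < 1 := (WP 0 n0).2.
have X1' := ltW X1.
have [Xs XsE] := op_adjoint X.
have [D [_ Dl Dr]] := one_sub_adjoint_inverse XsE X1 X1'.
pose a := u - Xs (W 1 u).
pose p := D a; have aE : a = p - Xs (X p) by rewrite Dl.
have /choice[U UP] : forall z, exists v, nr z < rho -> v - Xs (W z v) = a.
  move=> z; have [zr|zr] := ltP (nr z) rho; last by exists 0.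
  have [B [_ Bl _]] := one_sub_adjoint_inverse XsE X1 (ltW (WP z zr).2).
  by exists (B a).
have U1 : U 1 = u.
  have [B [_ _ Br]] := one_sub_adjoint_inverse XsE X1 (ltW (WP 1 n1).2).
  by rewrite -(Br (U 1)) UP// /a Br.
pose n z := W z (U z) - X p.
have Udecomp z : nr z < rho -> U z = p + Xs (n z) /\ W z (U z) = X p + n z.
  move=> zr; split; last by rewrite /n addrC subrK.
  by rewrite -[LHS](subrK (Xs (W z (U z)))) UP// aE /n (linB Xs); lmod.
have npos z : nr z < rho -> codefect Xs (n z) <= defect X p.
  move=> zr; have [E1 E2] := Udecomp z zr.
  have := @defect_ge0 _ _ _ (W z) (U z) (ltW (WP z zr).2).
  by rewrite /defect E2 {1}E1 (krein_pythagoras XsE) subr_ge0.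
pose b := n 1.
(* Equal to the codefect form at n z and b by fE, but manifestly holomorphic. *)
pose f z : R[i]^o := hdot ((W z - X) (U z)) b.
have fE z : nr z < rho -> f z = codefect_form Xs (n z) b.
  move=> zr; have [E1 E2] := Udecomp z zr.
  rewrite /f /codefect_form opDE opNE E2 {1}E1 (appD X) -XsE -dotBl.
  by congr (hdot _ _); lmod.
have Ud z : nr z < rho -> cdiff U z.
  move=> zr; have [Wd Wz1] := WP z zr.
  apply: (@cdiff_resolvent X Xs W U a z (rho - nr z)) => //; first by rewrite subr_gt0.
  move=> w wz; have wr : nr w < rho.
    by have := nrD z (w - z); rewrite addrC subrK; move: wz; clear; lra.
  by split; [apply: ltW; exact: (WP w wr).2 | exact: UP].
have fd z : nr z < rho -> cdiff f z.
  move=> zr; have [[W' Wd] _] := WP z zr; have [U' Udz] := Ud z zr.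
  have WXd : cderiv (fun w => W w - X) z (W' + 0).
    apply: (@cderivD _ 'L(K, H) W (fun=> - X)) => //.
    move=> e e0; exists 1 => // w _.
    by rewrite subrr scaler0 subr0 nr0 mulr_ge0 ?nr_ge0// ltW.
  have appd := @cderiv_bilin _ _ _ H (fun (T : 'L(K, H)) (v : K) => T v) 1 _ _ _ _ _
    (fun k x x' y => erefl) (fun k x y y' => app_linear x k y y') ler01
    (fun x y => ltac:(by rewrite mul1r; exact: nr_app)) WXd Udz.
  by apply: cdiff_dot; eexists; exact: appd.
have f0 : f 0 = 0 by rewrite /f opDE opNE -/X subrr dot0l.
have P0 : 0 <= defect X p by apply: defect_ge0.
have b0 : 0 <= codefect Xs b by apply: (codefect_ge0 XsE).
pose F := Num.sqrt (defect X p * codefect Xs b).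
have fF z : nr z < rho -> nr (f z : R[i]) <= F.
  move=> zr; rewrite -(@ler_pXn2r _ 2) ?nnegrE ?nr_ge0 ?sqrtr_ge0//.
  rewrite sqr_sqrtr ?mulr_ge0// fE//.
  apply: le_trans (codefect_cauchy_schwarz XsE _ _ X1') _.
  by rewrite ler_wpM2r// npos.
have := schwarz rho1 fd f0 fF.
rewrite (fE 1 n1) -/b => le_F.
have le_F2 : rho ^+ 2 * codefect Xs b ^+ 2 <= defect X p * codefect Xs b.
  rewrite -[leRHS]sqr_sqrtr ?mulr_ge0// -/F.
  have f1 : nr (codefect_form Xs b b) = codefect Xs b.
    by rewrite /codefect_form !dot_nr -rmorphB /= nr_real ger0_norm.
  rewrite -f1 -exprMn; apply: lerXn2r le_F; rewrite nnegrE ?sqrtr_ge0//.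
  by rewrite mulr_ge0 ?nr_ge0//; lra.
have le_P : rho ^+ 2 * codefect Xs b <= defect X p.
  have [b_gt0|b_le0] := ltP 0 (codefect Xs b).
    by rewrite -(ler_pM2r b_gt0) -mulrA -expr2.
  by have -> : codefect Xs b = 0 by [lra]; rewrite mulr0.
have [E1 E2] := Udecomp 1 n1; rewrite U1 -/b in E1 E2.
have vE : defect (W 1) u = defect X p - codefect Xs b.
  by rewrite -(krein_pythagoras XsE) /defect E2 -E1.
have le_c : defect X p <= c * defect (W 1) u.
  rewrite vE; have c1' : 0 < c - 1 by lra.
  have : c * codefect Xs b <= (c - 1) * defect X p.
    rewrite -(ler_pM2l c1') in le_P.
    apply: le_trans le_P; rewrite rhoE le_eqVlt; apply/orP; left; apply/eqP.
    by field; rewrite gt_eqF.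
  lra.
have -> : hdot u a' - hdot (W 1 u) (X a') = defect_form X p a'.
  have XsE' h k : hdot h (X k) = hdot (Xs h) k by rewrite dotC XsE -dotC.
  by rewrite /defect_form !XsE' -!dotBl -/a aE.
apply: le_trans (defect_cauchy_schwarz _ _ X1') _.
by rewrite ler_wpM2r// defect_ge0.
Qed.

End SchwarzPickOperators.

(** * Holomorphic discs through two points of the ball *)

Section GeodesicDisc.
Context {R : realType} {H K : hilbertType R[i]}.
Hypothesis finK : finite_dimensional K.
Implicit Types (X Y : 'L(K, H)) (u v p : K).

(** Splitting the graph of [Y] along the graph of [X] and its orthogonal complement
    presents it as the graph of an operator [Z] from the former to the latter; the
    hypothesis on [c] bounds [Z] in the norms given by the indefinite form. *)
Lemma displacement X (Xs : {linear H -> K}) Y (c : R) :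
  (forall k h, hdot (X k) h = hdot k (Xs h)) -> nr X < 1 -> nr Y < 1 -> 1 < c ->
  cosh2_le c X Y -> exists Z : K -> H,
  [/\ linear Z, forall p, c * codefect Xs (Z p) <= (c - 1) * defect X p &
    forall u, exists p, u = p + Xs (Z p) /\ Y u = X p + Z p].
Proof.
move=> XsE X1 Y1 c1 cXY.
have [U [linU Ul Ur]] := one_sub_adjoint_inverse finK XsE X1 (ltW Y1).
have [D [_ Dl Dr]] := one_sub_adjoint_inverse finK XsE X1 (ltW X1).
pose Up p := U (p - Xs (X p)).
pose Z p := Y (Up p) - X p.
have UpE p : Up p = p + Xs (Z p).
  have h := Ul (p - Xs (X p)); rewrite -/(Up p) in h.
  by rewrite -[LHS](subrK (Xs (Y (Up p)))) h /Z (linB Xs); lmod.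
have YUp p : Y (Up p) = X p + Z p by rewrite /Z addrC subrK.
have linUp : linear Up.
  move=> a x y; rewrite /Up -linU; congr U.
  by rewrite (app_linear X) (linD Xs) (linZ Xs); lmod.
have lin_Z : linear Z.
  by move=> a x y; rewrite /Z linUp (app_linear Y) (app_linear X); lmod.
exists Z; split=> //.
- move=> p.
  have vE : defect Y (Up p) = defect X p - codefect Xs (Z p).
    by rewrite -(krein_pythagoras XsE) /defect YUp -UpE.
  have := cXY (Up p) p.
  have -> : hdot (Up p) p - hdot (Y (Up p)) (X p) = (defect X p)%:C.
    have XsE' h k : hdot h (X k) = hdot (Xs h) k by rewrite dotC XsE -dotC.
    rewrite XsE' -dotBl YUp (linD Xs) {1}UpE.
    rewrite [X in hdot X p](_ : _ = p - Xs (X p)); last by lmod.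
    by rewrite dotBl -XsE' !dot_nr -rmorphB.
  have P0 : 0 <= defect X p by apply: defect_ge0; exact: ltW.
  rewrite nr_real ger0_norm// vE.
  have N0 := codefect_ge0 XsE (Z p) (ltW X1).
  move=> h; have [P_gt0|P_le0] := ltP 0 (defect X p).
    move: h; rewrite expr2 ler_pM2r// => h; lra.
  have P_eq0 : defect X p = 0 by lra.
  have p0 : p = 0.
    have := defect_ge p (lexx (nr X)); rewrite P_eq0.
    have r1 : 0 < 1 - nr X ^+ 2 by have := nr_ge0 X; nra.
    rewrite pmulr_rle0// => h2; apply: nr_eq0; apply/eqP.
    by rewrite -sqrf_eq0 eq_le h2 sqr_ge0.
  have -> : Z p = 0.
    by have := lin_Z (-1) 0 0; rewrite p0 scaler0 addr0 scaleN1r addNr.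
  by rewrite /codefect linear0 !nr0 P_eq0 !expr0n subrr !mulr0.
- move=> u; exists (D (u - Xs (Y u))).
  have E : Up (D (u - Xs (Y u))) = u by rewrite /Up Dl Ur.
  by rewrite -UpE -YUp E.
Qed.

Lemma sqr_le_linear (q x y : R) : 0 < q <= 1 -> 0 <= x -> 0 <= y ->
  q * x ^+ 2 <= y ^+ 2 -> x <= q^-1 * y.
Proof.
move=> /andP[q0 q1] x0 y0 h; rewrite mulrC ler_pdivlMr//.
rewrite -(@ler_pXn2r _ 2) ?nnegrE ?mulr_ge0 ?(ltW q0)//.
by apply: le_trans h; nra.
Qed.

(** Replacing the operator [Z] of [displacement] by [z Z] gives operators [V z] with
    [V 0 = X] and [V 1 = Y], and [codefect (z Z p) < defect p] for [|z| < rho] and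
    nonzero [p], so that their graphs stay positive. *)
Lemma geodesic_disc X Y (c rho : R) : nr X < 1 -> nr Y < 1 ->
  1 < c -> 1 < rho -> rho ^+ 2 = c / (c - 1) -> cosh2_le c X Y ->
  exists V : R[i] -> 'L(K, H), [/\ V 0 = X, V 1 = Y &
    forall z, nr z < rho -> cdiff V z /\ nr (V z) < 1].
Proof.
move=> X1 Y1 c1 rho1 rhoE cXY.
have [Xs XsE] := op_adjoint finK X.
have [Z [lin_Z Zle Zsurj]] := displacement XsE X1 Y1 c1 cXY.
pose q := 1 - nr X ^+ 2.
have q01 : 0 < q <= 1.
  by rewrite /q; have := nr_ge0 X => X0; apply/andP; split; nra.
have /andP[q0 q1] := q01.
have rho0 : 0 < rho ^+ 2 by apply: exprn_gt0; lra.
have Zle' p : rho ^+ 2 * codefect Xs (Z p) <= defect X p.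
  have c1' : 0 < c - 1 by lra.
  rewrite -(ler_pM2l c1'); apply: le_trans (Zle p); rewrite rhoE le_eqVlt.
  by apply/orP; left; apply/eqP; field; rewrite gt_eqF.
have Zb p : nr (Z p) <= q^-1 * nr p.
  apply: sqr_le_linear => //; rewrite ?nr_ge0//.
  apply: le_trans (codefect_ge XsE (Z p) (lexx _)) _.
  apply: le_trans (defect_le X p); apply: le_trans (Zle' p).
  rewrite ler_peMl ?(codefect_ge0 XsE) ?(ltW X1)//.
  by rewrite exprn_ege1// ltW.
have XsT h : nr (Xs h) <= nr h.
  apply: le_trans (nr_adjoint XsE h) _.
  by rewrite ler_piMl ?nr_ge0// ltW.
have Tb p : nr (Xs (Z p)) <= q^-1 * nr p by apply: le_trans (XsT _) (Zb p).
(* V z u = X p + z Z p where A z p = u. *)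
pose A z p := p + z *: Xs (Z p).
pose s (z : R[i]) := 1 - nr z ^+ 2 / rho ^+ 2.
have s01 z : nr z < rho -> 0 < s z <= 1.
  move=> zr; have := nr_ge0 z => z0; rewrite /s; apply/andP; split.
    by rewrite subr_gt0 ltr_pdivrMr// mul1r ltrXn2r ?nnegrE//; lra.
  by rewrite gerBl divr_ge0 ?sqr_ge0.
have key z p : nr z < rho ->
    s z * q * nr p ^+ 2 <= nr (A z p) ^+ 2 - nr (X p + z *: Z p) ^+ 2.
  move=> zr; rewrite /A -(linZ Xs) (krein_pythagoras XsE) (codefectZ Xs).
  have h1 := defect_ge p (lexx (nr X)); rewrite -/q in h1.
  have /andP[h2 _] := s01 z zr.
  apply: le_trans (_ : s z * defect X p <= _).
    by rewrite -mulrA ler_wpM2l// ltW.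
  rewrite /s mulrBl mul1r lerD2l lerN2.
  rewrite [leRHS](_ : _ = nr z ^+ 2 * (defect X p / rho ^+ 2)); last by ring.
  by rewrite ler_wpM2l ?sqr_ge0// ler_pdivlMr// mulrC.
have sq01 z : nr z < rho -> 0 < s z * q <= 1.
  move=> /s01/andP[s0 s1]; rewrite mulr_gt0//= .
  by apply: le_trans (_ : s z <= 1) => //; rewrite ler_piMr// ltW.
have lin_A z : linear (A z).
  by move=> a x y; rewrite /A lin_Z (linD Xs) (linZ Xs); lmod.
have inj_A z : nr z < rho -> forall p, A z p = 0 -> p = 0.
  move=> zr p Ap; have := key z p zr; rewrite Ap nr0 expr0n /= sub0r => h.
  have /andP[h0 _] := sq01 z zr.
  apply: nr_eq0; apply/eqP; rewrite -sqrf_eq0 eq_le sqr_ge0 andbT.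
  rewrite -(pmulr_rle0 _ h0); apply: le_trans h _.
  by rewrite oppr_le0 sqr_ge0.
have /choice[P PP] : forall z, exists B : K -> K, nr z < rho ->
    [/\ linear B, forall u, A z (B u) = u & forall u, B (A z u) = u].
  move=> z; have [zr|zr] := ltP (nr z) rho; last by exists id.
  by have [B BP] := lin_inverse finK (lin_A z) (inj_A z zr); exists B.
have Pb z u : nr z < rho -> nr (P z u) <= (s z * q)^-1 * nr u.
  move=> zr; apply: sqr_le_linear; rewrite ?sq01 ?nr_ge0//.
  apply: le_trans (key z (P z u) zr) _.
  by have [_ -> _] := PP z zr; rewrite gerBl sqr_ge0.
pose M := 1 + rho / q.
have M1 : 1 <= M by rewrite lerDl divr_ge0 ?(ltW q0)//; lra.
pose theta z := 1 - s z * q / M ^+ 2.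
have M2 : 0 < M ^+ 2 by apply: exprn_gt0; lra.
have th z : nr z < rho -> 0 <= theta z < 1.
  move=> zr; have /andP[h0 h1] := sq01 z zr.
  have d0 : 0 < s z * q / M ^+ 2 by rewrite divr_gt0.
  have d1 : s z * q / M ^+ 2 <= 1.
    by rewrite ler_pdivrMr// mul1r; apply: le_trans h1 _; rewrite exprn_ege1.
  by rewrite /theta; apply/andP; split; lra.
have AM z p : nr z < rho -> nr (A z p) <= M * nr p.
  move=> zr; apply: le_trans (nrD _ _) _; rewrite nrZ /M mulrDl mul1r lerD2l.
  by rewrite -mulrA ler_pM ?nr_ge0// ltW.
have Vb z u : nr z < rho ->
    nr (X (P z u) + z *: Z (P z u)) <= Num.sqrt (theta z) * nr u.
  move=> zr; have [_ Pl _] := PP z zr; have /andP[t0 t1] := th z zr.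
  have /andP[h0 h1] := sq01 z zr.
  rewrite -(@ler_pXn2r _ 2) ?nnegrE ?mulr_ge0 ?nr_ge0 ?sqrtr_ge0//.
  rewrite exprMn sqr_sqrtr//.
  have h := key z (P z u) zr; rewrite Pl in h.
  have hM := AM z (P z u) zr; rewrite Pl in hM.
  have hM2 : nr u ^+ 2 <= M ^+ 2 * nr (P z u) ^+ 2.
    by rewrite -exprMn lerXn2r ?nnegrE ?mulr_ge0 ?nr_ge0//; lra.
  have : s z * q / M ^+ 2 * nr u ^+ 2 <= s z * q * nr (P z u) ^+ 2.
    rewrite -!mulrA ler_wpM2l//; first by have /andP[/ltW] := s01 z zr.
    by rewrite ler_wpM2l ?(ltW q0)// mulrC ler_pdivrMr// mulrC.
  move=> h3.
  rewrite (_ : theta z * _ = nr u ^+ 2 - s z * q / M ^+ 2 * nr u ^+ 2).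
    by move: h h3; clear; lra.
  by rewrite /theta; ring.
have /choice[V VP] : forall z, exists V : 'L(K, H), nr z < rho ->
    (forall u, V u = X (P z u) + z *: Z (P z u)) /\ nr V < 1.
  move=> z; have [zr|zr] := ltP (nr z) rho; last by exists 0.
  have [lin_P _ _] := PP z zr.
  have lin_V : linear (fun u => X (P z u) + z *: Z (P z u)).
    by move=> a x y; rewrite lin_P lin_Z (app_linear X); lmod.
  have [V VE] := op_of_linear lin_V (fun u => Vb z u zr).
  exists V => _; split=> //.
  have /andP[t0 t1] := th z zr.
  apply: le_lt_trans (_ : Num.sqrt (theta z) < 1).
    by apply: nr_op_le => [|u]; rewrite ?sqrtr_ge0// VE Vb.
  by rewrite -sqrtr1 ltr_sqrt.
have n0 : nr (0 : R[i]) < rho by rewrite nr0; lra.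
have n1 : nr (1 : R[i]) < rho by rewrite nr1; lra.
exists V; split.
- apply: op_eq => u; have [-> _] := VP 0 n0; have [_ _ Pr] := PP 0 n0.
  have E : A 0 u = u by rewrite /A scale0r addr0.
  by rewrite -{1 2}E Pr scale0r addr0.
- apply: op_eq => u; have [-> _] := VP 1 n1; have [_ _ Pr] := PP 1 n1.
  have [p [uE YuE]] := Zsurj u.
  have E : A 1 p = u by rewrite /A scale1r.
  by rewrite -E Pr scale1r E.
move=> z zr; have [VE V1] := VP z zr; split=> //.
have [lin_P Pl _] := PP z zr.
pose G u := Z (P z u) - V z (Xs (Z (P z u))).
pose C := q^-1 * (s z * q)^-1.
have C0 : 0 <= C.
  have /andP[h0 _] := sq01 z zr.
  by rewrite mulr_ge0// invr_ge0 ltW.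
have ZPb u : nr (Z (P z u)) <= C * nr u.
  by apply: le_trans (Zb _) _; rewrite /C -mulrA ler_wpM2l ?invr_ge0 ?(ltW q0) ?Pb.
have TPb u : nr (Xs (Z (P z u))) <= C * nr u by apply: le_trans (XsT _) (ZPb u).
have Gb w u : nr w < rho ->
    nr (Z (P z u) - V w (Xs (Z (P z u)))) <= 2 * C * nr u.
  move=> wr; have [_ /ltW Vw1] := VP w wr.
  apply: le_trans (nrB _ _) _; rewrite mulr2n !mulrDl !mul1r; apply: lerD => //.
  apply: le_trans (nr_app _ _) _; apply: le_trans (TPb u).
  by rewrite ler_piMl ?nr_ge0.
have lin_G : linear G.
  by move=> a x y; rewrite /G lin_P lin_Z (linD Xs) (linZ Xs) (app_linear (V z)); lmod.
have [D DE] := op_of_linear lin_G (fun u => Gb z u zr).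
(* A resolvent identity, by which V is first Lipschitz and then differentiable. *)
have diff w u : nr w < rho -> V w u - V z u =
    (w - z) *: (Z (P z u) - V w (Xs (Z (P z u)))).
  move=> wr; have [VwE _] := VP w wr; have [_ _ Pwr] := PP w wr.
  have h p : V w (p + w *: Xs (Z p)) = X p + w *: Z p by rewrite VwE Pwr.
  have uE : u = P z u + z *: Xs (Z (P z u)) by rewrite -/(A z (P z u)) Pl.
  have -> : V w u = X (P z u) + w *: Z (P z u) - (w - z) *: V w (Xs (Z (P z u))).
    by rewrite -h -(appZ (V w)) -(appB (V w)) {1}uE; congr (V w _); lmod.
  by rewrite VE; lmod.
exists D; apply: (@cderiv_quad _ _ _ _ _ (rho - nr z) (2 * C * C)).
  by rewrite subr_gt0.
move=> w wz.
have wr : nr w < rho by have := nrD z (w - z); rewrite addrC subrK; lra.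
apply: nr_op_le => [|u]; first by rewrite mulr_ge0 ?sqr_ge0// mulr_ge0// mulr_ge0.
have -> : (V w - V z - (w - z) *: D) u =
    - ((w - z) *: ((w - z) *: (Z (P z (Xs (Z (P z u))))
        - V w (Xs (Z (P z (Xs (Z (P z u))))))))).
  rewrite -diff// [LHS](_ : _ = V w u - V z u - (w - z) *: D u)//.
  by rewrite diff// DE /G; lmod.
rewrite nrN !nrZ mulrA -expr2 [leRHS](_ : _ =
  nr (w - z) ^+ 2 * (2 * C * (C * nr u))); last by ring.
rewrite ler_wpM2l ?sqr_ge0//; apply: le_trans (Gb w _ wr) _.
by rewrite ler_wpM2l// mulr_ge0.
Qed.

End GeodesicDisc.

(** * Holomorphic maps do not increase the distance *)

Section Invariance.
Context {R : realType}.

Lemma differentiable_expansion (V W : normedModType R[i]) (phi : V -> W) (x : V) :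
  differentiable phi x -> exists (L : {linear V -> W}) (C : R),
  [/\ 0 < C, forall v, nr (L v) <= C * nr v &
    forall e : R, 0 < e -> exists2 r : R, 0 < r & forall v, nr v < r ->
      nr (phi (v + x) - phi x - L v) <= e * nr v].
Proof.
move=> /diff_locallyP[dc /eqaddoP dphi].
have /linear_boundedP/pinfty_ex_gt0[c /= c0 cL] :=
  (linear_bounded_continuous ('d phi x)).2 dc.
have [cE C0] := Re_gt0 c0.
exists ('d phi x), (complex.Re c); split=> //.
  by move=> v; rewrite -lecR rmorphM /= !nrE cE.
move=> e e0; have := dphi e%:C; rewrite ltcR => /(_ e0).
move=> /nbhs_normP[r /= r0 hr]; have [rE Cr] := Re_gt0 r0.
exists (complex.Re r) => // v vr.
rewrite -lecR rmorphM /= !nrE.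
have -> : phi (v + x) - phi x - 'd phi x v =
    (phi \o shift x - (cst (phi x) + 'd phi x)) v.
  by rewrite /= !fctE /= opprD addrA.
by apply: hr; rewrite /= /ball_ /= sub0r normrN -nrE -rE ltcR.
Qed.

Lemma cdiff_comp (V W : normedModType R[i]) (phi : V -> W) (f : R[i] -> V) z :
  differentiable phi (f z) -> cdiff f z -> cdiff (fun w => phi (f w)) z.
Proof.
move=> /differentiable_expansion[L [C [C0 LC phiL]]] [d fd].
exists (L d) => e e0.
have d0 := nr_ge0 d; have d1 : 0 < nr d + 1 by lra.
have [r r0 {}phiL] := phiL (e / 2 / (nr d + 1)) ltac:(by rewrite !divr_gt0).
have [r1 r10 lip] := cderiv_lip fd.
have [r2 r20 {}fd] := fd (e / 2 / C) ltac:(by rewrite !divr_gt0).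
exists (Num.min r1 (Num.min r2 (r / (nr d + 1)))).
  by rewrite !lt_min r10 r20 divr_gt0.
move=> w; rewrite !lt_min ltr_pdivlMr// => /and3P[w1 w2 w3].
have {}lip := lip w w1; have {}fd := fd w w2; set h := w - z in w1 w2 w3 lip fd *.
have {}phiL := phiL (f w - f z) ltac:(apply: le_lt_trans lip _; rewrite mulrC; exact: w3).
rewrite subrK in phiL.
have LE : L (f w - f z - h *: d) = L (f w - f z) - h *: L d.
  by rewrite linearB linearZ.
have -> : phi (f w) - phi (f z) - h *: L d =
    (phi (f w) - phi (f z) - L (f w - f z)) + L (f w - f z - h *: d).
  by rewrite LE; lmod.
apply: le_trans (nrD _ _) _; apply: le_trans (lerD phiL (LC _)) _.
have a1 : e / 2 / (nr d + 1) * nr (f w - f z) <= e / 2 * nr h.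
  rewrite [leRHS](_ : _ = e / 2 / (nr d + 1) * ((nr d + 1) * nr h)).
    by rewrite ler_wpM2l// ltW// !divr_gt0.
  by field; rewrite gt_eqF.
have a2 : C * nr (f w - f z - h *: d) <= e / 2 * nr h.
  apply: le_trans (ler_wpM2l (ltW C0) fd) _.
  rewrite le_eqVlt; apply/orP; left; apply/eqP; field; by rewrite gt_eqF.
lra.
Qed.

Section Ball.
Context {V : normedModType R[i]}.

Lemma ball_nr (X : unit_ball V) : nr (val X) < 1.
Proof. by rewrite -ltcR nrE; exact: (valP X). Qed.

Lemma ball_of (v : V) : nr v < 1 -> exists X : unit_ball V, val X = v.
Proof.
move=> v1; have v1' : `|v| < 1 by rewrite -nrE ltcR.
by exists (exist _ v v1').
Qed.

Lemma extend0_val (g : unit_ball V -> unit_ball V) X :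
  extend0 g (val X) = val (g X).
Proof. by rewrite /extend0 valK. Qed.
End Ball.

Context {H K : hilbertType R[i]}.
Hypothesis finK : finite_dimensional K.

(** The disc of [geodesic_disc] through [X] and [Y] is mapped by [g] to a disc through
    their images, to which [schwarz_pick] applies. *)
Lemma cosh2_le_holomorphic (g : unit_ball 'L(K, H) -> unit_ball 'L(K, H)) (c : R)
    (X Y : unit_ball 'L(K, H)) : holomorphic g -> 1 < c ->
  cosh2_le c (val X) (val Y) -> cosh2_le c (val (g X)) (val (g Y)).
Proof.
move=> hol_g c1 cXY.
(* If the distance of X and Y has hyperbolic cosine sqrt c, then its hyperbolic
   tangent is 1 / rho: rho is the radius of a disc in which 0 and 1 are at the
   same distance as X and Y. *)
pose rho := Num.sqrt (c / (c - 1)).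
have c1' : 0 < c - 1 by lra.
have cc1 : 1 < c / (c - 1) by rewrite ltr_pdivlMr//; lra.
have rhoE : rho ^+ 2 = c / (c - 1) by rewrite sqr_sqrtr//; lra.
have rho1 : 1 < rho by rewrite -[ltLHS]sqrtr1 ltr_sqrt//; lra.
have [V [V0 V1 VP]] := geodesic_disc finK (ball_nr X) (ball_nr Y) c1 rho1 rhoE cXY.
rewrite -(extend0_val g X) -(extend0_val g Y) -V0 -V1.
apply: (schwarz_pick finK (W := fun z => extend0 g (V z)) c1 rho1 rhoE) => z zr.
have [Vd Vz1] := VP z zr; have [Z ZE] := ball_of Vz1.
split; last by rewrite -ZE extend0_val ball_nr.
by apply: cdiff_comp => //; rewrite -ZE; exact: hol_g.
Qed.

End Invariance.

(** * Convexity of balls and non-diametral points *)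

Section NonDiametral.
Context {R : realType} {H K : hilbertType R[i]}.
Hypothesis finK : finite_dimensional K.
Implicit Types (X Y A : 'L(K, H)) (u a : K) (M : set 'L(K, H)).

Definition slack (c : R) X Y u a : R :=
  c * defect Y u * defect X a - nr (hdot u a - hdot (Y u) (X a)) ^+ 2.

Lemma cosh2_leP c X Y : cosh2_le c X Y <-> forall u a, 0 <= slack c X Y u a.
Proof. by split=> h u a; have := h u a; rewrite subr_ge0. Qed.

Lemma cosh2_le_mono c c' X Y : nr X <= 1 -> nr Y <= 1 -> c <= c' ->
  cosh2_le c X Y -> cosh2_le c' X Y.
Proof.
move=> X1 Y1 cc' h u a; apply: le_trans (h u a) _.
by rewrite ler_wpM2r ?defect_ge0// ler_wpM2r ?defect_ge0.
Qed.

Lemma cosh2_le_lim c X Y : nr X <= 1 -> nr Y <= 1 ->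
  (forall e, 0 < e -> cosh2_le (c + e) X Y) -> cosh2_le c X Y.
Proof.
move=> X1 Y1 h u a; rewrite -mulrA; apply/ler_addgt0Pr => e e0.
have t0 : 0 <= defect Y u * defect X a by rewrite mulr_ge0 ?defect_ge0.
set t := _ * _ in t0 *; have t1 : 0 < t + 1 by lra.
have := h (e / (t + 1)) ltac:(by rewrite divr_gt0) u a.
rewrite -mulrA -/t => {}h; apply: le_trans h _; rewrite mulrDl lerD2l.
by rewrite mulrAC ler_pdivrMr// ler_wpM2l ?(ltW e0)// lerDl.
Qed.

Lemma cosh2_le1_eq X Y : nr X <= 1 -> nr Y <= 1 -> cosh2_le 1 X Y -> X = Y.
Proof.
move=> X1 Y1 h; apply: op_eq => u; apply/eqP; rewrite -subr_eq0; apply/eqP.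
apply: nr_eq0; apply/eqP; rewrite -sqrf_eq0 eq_le sqr_ge0 andbT nr_sqrB.
have := h u u; rewrite mul1r; set z := _ - _ => hz.
have rz : complex.Re z = nr u ^+ 2 - complex.Re (hdot (X u) (Y u)).
  rewrite /z dot_nr -(Re_dotC (X u)).
  by case: (hdot (Y u) (X u)) => ? ?.
have hz2 : complex.Re z ^+ 2 <= defect Y u * defect X u.
  by apply: le_trans hz; rewrite nr_sqr lerDl sqr_ge0.
have DX := defect_ge0 u X1; have DY := defect_ge0 u Y1.
have : complex.Re z <= (defect X u + defect Y u) / 2.
  have [z0|z0] := leP 0 (complex.Re z); last by lra.
  rewrite -(@ler_pXn2r _ 2) ?nnegrE//; last by lra.
  apply: le_trans hz2 _; have := sqr_ge0 (defect X u - defect Y u).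
  by rewrite !expr2; lra.
by rewrite rz /defect; lra.
Qed.

Lemma cosh2_le_bounded (r : R) X Y : nr X <= r -> nr Y <= r -> r < 1 ->
  cosh2_le (4 / (1 - r ^+ 2) ^+ 2) X Y.
Proof.
move=> Xr Yr r1 u a; have X0 := nr_ge0 X; have Y0 := nr_ge0 Y.
have q0 : 0 < 1 - r ^+ 2 by nra.
have Xa := nr_app X a; have Yu := nr_app Y u.
have u0 := nr_ge0 u; have a0 := nr_ge0 a.
have hX : nr (X a) <= nr a by apply: le_trans Xa _; rewrite ler_piMl//; lra.
have hY : nr (Y u) <= nr u by apply: le_trans Yu _; rewrite ler_piMl//; lra.
have le2 : nr (hdot u a - hdot (Y u) (X a)) <= 2 * nr u * nr a.
  apply: le_trans (nrB _ _) _.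
  have := cauchy_schwarz u a; have := cauchy_schwarz (Y u) (X a).
  have : nr (Y u) * nr (X a) <= nr u * nr a by rewrite ler_pM ?nr_ge0.
  lra.
apply: le_trans (_ : (2 * nr u * nr a) ^+ 2 <= _).
  by rewrite lerXn2r ?nnegrE ?nr_ge0 ?mulr_ge0.
have dX := defect_ge a Xr; have dY := defect_ge u Yr.
apply: le_trans (_ : 4 / (1 - r ^+ 2) ^+ 2 * ((1 - r ^+ 2) * nr u ^+ 2)
    * ((1 - r ^+ 2) * nr a ^+ 2) <= _).
  by rewrite le_eqVlt; apply/orP; left; apply/eqP; field; rewrite gt_eqF.
have k0 : 0 <= 4 / (1 - r ^+ 2) ^+ 2 by rewrite divr_ge0 ?exprn_ge0// ltW.
have e1 : 0 <= (1 - r ^+ 2) * nr u ^+ 2 by rewrite mulr_ge0 ?sqr_ge0// ltW.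
have e2 : 0 <= (1 - r ^+ 2) * nr a ^+ 2 by rewrite mulr_ge0 ?sqr_ge0// ltW.
by apply: ler_pM => //; [exact: mulr_ge0 | exact: ler_wpM2l].
Qed.

(** Balls for the hyperbolic distance stay away from the boundary: take [a = u] in the
    definition of [cosh2_le]. *)
Lemma cosh2_le_ball (r c : R) X : nr X <= r -> r < 1 -> 1 < c ->
  exists2 s : R, s < 1 & forall Y, cosh2_le c X Y -> nr Y <= s.
Proof.
move=> Xr r1 c1; pose q := (1 - r) ^+ 2 / c.
have r0 : 0 <= r by apply: le_trans Xr; exact: nr_ge0.
have q01 : 0 < q <= 1.
  have c0 : 0 < c by lra.
  have r1' : 0 < 1 - r by lra.
  have sq1 : (1 - r) ^+ 2 <= 1 by rewrite expr_le1//; lra.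
  rewrite /q; apply/andP; split; first by rewrite divr_gt0// exprn_gt0.
  by rewrite ler_pdivrMr//; lra.
have /andP[q0 q1] := q01.
exists (Num.sqrt (1 - q)).
  by rewrite -[ltRHS]sqrtr1 ltr_sqrt ?ltr01//; lra.
move=> Y cXY; apply: nr_op_le => [|u]; first exact: sqrtr_ge0.
rewrite -(@ler_pXn2r _ 2) ?nnegrE ?mulr_ge0 ?nr_ge0 ?sqrtr_ge0//.
rewrite exprMn sqr_sqrtr; last by lra.
have [->|u_neq0] := eqVneq u 0.
  by rewrite (_ : Y 0 = 0) ?nr0 ?expr0n ?mulr0//; exact: linear0.
have u0 := nr_gt0 u_neq0.
have DX : 0 < defect X u.
  by apply: lt_le_trans (defect_ge u Xr); rewrite mulr_gt0 ?exprn_gt0//; nra.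
have DXle := defect_le X u.
have h := cXY u u.
have DY : 0 <= defect Y u.
  have : 0 <= c * defect Y u * defect X u by apply: le_trans h; exact: sqr_ge0.
  by rewrite pmulr_lge0// pmulr_rge0//; lra.
have Yle : nr (Y u) <= nr u.
  rewrite -(@ler_pXn2r _ 2) ?nnegrE ?nr_ge0//.
  by rewrite -subr_ge0.
have low : (1 - r) * nr u ^+ 2 <= nr (hdot u u - hdot (Y u) (X u)).
  have h1 := nrD (hdot u u - hdot (Y u) (X u) : R[i]) (hdot (Y u) (X u)).
  rewrite subrK dot_nr nr_real ger0_norm ?sqr_ge0// in h1.
  have h2 := cauchy_schwarz (Y u) (X u).
  have h3 := nr_app X u.
  have : nr (Y u) * nr (X u) <= nr u * (r * nr u).
    rewrite ler_pM ?nr_ge0//; apply: le_trans h3 _.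
    by rewrite ler_wpM2r// ltW.
  by rewrite dot_nr; lra.
have : ((1 - r) * nr u ^+ 2) ^+ 2 <= c * defect Y u * nr u ^+ 2.
  apply: le_trans (_ : nr (hdot u u - hdot (Y u) (X u)) ^+ 2 <= _).
    rewrite lerXn2r ?nnegrE ?nr_ge0// mulr_ge0 ?sqr_ge0//; lra.
  apply: le_trans h _; rewrite ler_wpM2l// mulr_ge0//; lra.
have u2 : 0 < nr u ^+ 2 by rewrite exprn_gt0.
rewrite exprMn (expr2 (nr u ^+ 2)) mulrA ler_pM2r// => fin.
have : q * nr u ^+ 2 <= defect Y u.
  by rewrite /q mulrAC ler_pdivrMr; lra.
by rewrite /defect; lra.
Qed.

(** Uniform convexity of balls, with respect to the linear structure of the space of
    operators: the inequality that defines the ball around [X] becomes strict at a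
    midpoint, in every direction [u] in which the two operators differ. *)
Lemma slack_midpoint c X Y Y' u a :
  (slack c X Y u a + slack c X Y' u a) / 2
    + c * defect X a * nr (Y u - Y' u) ^+ 2 / 4
  <= slack c X ((1 / 2)%:C *: (Y + Y')) u a.
Proof.
rewrite /slack.
have midE : ((1 / 2)%:C *: (Y + Y')) u = (1 / 2)%:C *: (Y u + Y' u) by [].
have -> : defect ((1 / 2)%:C *: (Y + Y')) u =
    (defect Y u + defect Y' u) / 2 + nr (Y u - Y' u) ^+ 2 / 4.
  by rewrite /defect midE parallelogram; field.
have mid : nr (hdot u a - hdot (((1 / 2)%:C *: (Y + Y')) u) (X a)) ^+ 2 <=
    (nr (hdot u a - hdot (Y u) (X a)) ^+ 2
     + nr (hdot u a - hdot (Y' u) (X a)) ^+ 2) / 2.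
  rewrite midE dotZl dotDl !nr_sqr.
  case: (hdot u a) => p q; case: (hdot (Y u) _) => y1 y2.
  case: (hdot (Y' u) _) => y3 y4 /=.
  have s1 := sqr_ge0 (y1 - y3); have s2 := sqr_ge0 (y2 - y4).
  by rewrite !expr2 in s1 s2 *; lra.
apply: le_trans (lerB (lexx _) mid); rewrite le_eqVlt; apply/orP; left.
by apply/eqP; field.
Qed.

(** The point is that the constant is uniform in [X], [A] and [a]. *)
Lemma slack_perturb c X A u0 u a : nr X <= 1 -> nr A <= 1 -> 0 <= c ->
  nr (u - u0) <= 1 ->
  slack c X A u0 a - 4 * (nr u0 + 1) * (c + 2) * nr (u - u0) * nr a ^+ 2
  <= slack c X A u a.
Proof.
move=> X1 A1 c0 d1; set d := nr (u - u0) in d1 *; set m := nr u0.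
have d0 : 0 <= d := nr_ge0 _; have m0 : 0 <= m := nr_ge0 _.
have al0 := nr_ge0 a; set al := nr a in al0 *.
have Xa : nr (X a) <= al.
  by apply: le_trans (nr_app X a) _; rewrite ler_piMl.
have Ab v : nr (A v) <= nr v.
  by apply: le_trans (nr_app A v) _; rewrite ler_piMl ?nr_ge0.
pose p v := hdot v a - hdot (A v) (X a).
have pb v : nr (p v) <= 2 * nr v * al.
  apply: le_trans (nrB _ _) _.
  have := cauchy_schwarz v a; have := cauchy_schwarz (A v) (X a).
  have : nr (A v) * nr (X a) <= nr v * al by rewrite ler_pM ?nr_ge0.
  rewrite -/al; lra.
have pE : p u = p u0 + p (u - u0).
  by rewrite /p (appB A) !dotBl; ring.
have p1 : nr (p u) <= nr (p u0) + 2 * d * al.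
  by rewrite pE; apply: le_trans (nrD _ _) _; rewrite lerD2l pb.
have p2 : nr (p u) ^+ 2 <= nr (p u0) ^+ 2 + (8 * m + 4) * d * al ^+ 2.
  have k0 := nr_ge0 (p u0); have k1 := pb u0; rewrite -/m in k1.
  apply: le_trans (_ : (nr (p u0) + 2 * d * al) ^+ 2 <= _).
    by rewrite lerXn2r ?nnegrE ?nr_ge0 ?addr_ge0 ?mulr_ge0.
  rewrite sqrrD -addrA lerD2l.
  have e1 : nr (p u0) * (2 * d * al) <= 2 * m * al * (2 * d * al).
    by rewrite ler_wpM2r// !mulr_ge0.
  have e2 : (2 * d * al) ^+ 2 <= 4 * d * al ^+ 2.
    have da0 : 0 <= d * al ^+ 2 by rewrite mulr_ge0 ?sqr_ge0.
    have : d * (d * al ^+ 2) <= d * al ^+ 2 by rewrite ler_piMl.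
    by rewrite !expr2; lra.
  by rewrite mulr2n; rewrite !expr2 in e1 e2 *; lra.
have um : m <= nr u + d.
  by rewrite /d nr_distC; have := nrD u (u0 - u); rewrite addrC subrK.
have um' : nr u <= m + d.
  by have := nrD u0 (u - u0); rewrite addrC subrK.
have Au : nr (A u) <= nr (A u0) + d.
  have := nrD (A u0) (A (u - u0)); rewrite (appB A) addrC subrK => h.
  by apply: le_trans h _; rewrite lerD2l -(appB A) Ab.
have dA : defect A u0 - (4 * m + 4) * d <= defect A u.
  rewrite /defect -/m; have := nr_ge0 u; have := nr_ge0 (A u).
  have := nr_ge0 (A u0); have := Ab u0; rewrite -/m.
  move: (nr u) (nr (A u)) (nr (A u0)) um um' Au => x y z; clear -d0 d1 m0; nra.
have DX := defect_ge0 a X1; have DXle := defect_le X a; rewrite -/al in DXle.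
have fin : c * defect A u0 * defect X a - (4 * m + 4) * c * d * al ^+ 2
    <= c * defect A u * defect X a.
  have : c * defect X a * (defect A u0 - (4 * m + 4) * d)
      <= c * defect X a * defect A u by rewrite ler_wpM2l ?mulr_ge0.
  have : ((4 * m + 4) * c * d) * defect X a <= ((4 * m + 4) * c * d) * al ^+ 2.
    by rewrite ler_wpM2l// !mulr_ge0//; lra.
  clear; lra.
have extra : (8 * m + 4) * d * al ^+ 2 <= (8 * m + 8) * d * al ^+ 2.
  by rewrite ler_wpM2r ?sqr_ge0// ler_wpM2r//; lra.
rewrite /slack -/(p u) -/(p u0); move: p2 fin extra; clear; lra.
Qed.

Lemma slackZ c X Y k u a : slack c X Y (k *: u) a = nr k ^+ 2 * slack c X Y u a.
Proof.
rewrite /slack /defect (appZ Y) !dotZl -mulrBr !nrZ (@nrM R) !exprMn.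
ring.
Qed.

(** A convex set of diameter [c] has a point all of whose distances to the set are
    bounded by a smaller number. At a single direction [u] there is such a point: if
    two elements of [M] differ at [u], their midpoint, by [slack_midpoint]; otherwise
    any [A] in [M], because then each [X] in [M] agrees with [A] at [u], and the
    Cauchy-Schwarz inequality for the form of [X] holds with the constant 1 < c. The
    same point serves for nearby directions, and midpoints serve for unions of sets
    of directions, so that compactness of a sphere of [K] yields one point for all
    directions. *)
Lemma nondiametral M (r c : R) : M !=set0 ->
  (forall X, M X -> nr X <= r) -> r < 1 ->
  (forall X Y, M X -> M Y -> M ((1 / 2)%:C *: (X + Y))) -> 1 < c ->
  (forall X Y, M X -> M Y -> cosh2_le c X Y) ->
  exists2 A, M A & exists2 c', c' < c & forall X, M X -> cosh2_le c' X A.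
Proof.
move=> [A0 MA0] Mr r1 Mmid c1 cM.
have M1 X : M X -> nr X <= 1 by move=> /Mr; lra.
have sM X A u a : M X -> M A -> 0 <= slack c X A u a.
  by move=> MX MA; exact: (cosh2_leP c X A).1 (cM X A MX MA) u a.
have dM X a : M X -> (1 - r ^+ 2) * nr a ^+ 2 <= defect X a.
  by move=> /Mr; exact: defect_ge.
have r0 : 0 <= r by apply: le_trans (Mr _ MA0); exact: nr_ge0.
have q0 : 0 < 1 - r ^+ 2 by nra.
have [S cS [S0 Sscale]] := compact_sphere finK.
pose good (U : set K) := exists2 A, M A & exists2 e : R, 0 < e &
  forall u X a, U u -> M X -> e * nr u ^+ 2 * nr a ^+ 2 <= slack c X A u a.
have goodU U V : good U -> good V -> good (U `|` V).
  move=> [A MA [e e0 hA]] [B MB [f f0 hB]].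
  exists ((1 / 2)%:C *: (A + B)); first exact: Mmid.
  exists (Num.min e f / 2); first by rewrite divr_gt0// lt_min e0.
  move=> u X a UVu MX; apply: le_trans (slack_midpoint _ _ _ _ _ _).
  have pos : 0 <= c * defect X a * nr (A u - B u) ^+ 2 / 4.
    apply: divr_ge0 => //; apply: mulr_ge0; last exact: sqr_ge0.
    apply: mulr_ge0; [lra | exact: defect_ge0 a (M1 X MX)].
  have sA := sM X A u a MX MA; have sB := sM X B u a MX MB.
  have n0 : 0 <= nr u ^+ 2 * nr a ^+ 2 by rewrite mulr_ge0 ?sqr_ge0.
  have me : Num.min e f * (nr u ^+ 2 * nr a ^+ 2) <= e * (nr u ^+ 2 * nr a ^+ 2).
    by rewrite ler_wpM2r// ge_min lexx.
  have mf : Num.min e f * (nr u ^+ 2 * nr a ^+ 2) <= f * (nr u ^+ 2 * nr a ^+ 2).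
    by rewrite ler_wpM2r// ge_min lexx orbT.
  case: UVu => [/hA|/hB] /(_ _ a MX); move: pos sA sB me mf; clear; lra.
have pointwise u : u != 0 -> exists2 A, M A & exists2 e : R, 0 < e &
    forall X a, M X -> e * nr a ^+ 2 <= slack c X A u a.
  move=> u_neq0; have u0 := nr_gt0 u_neq0.
  have [[Y [Y' [MY MY' YY']]]|agree] :=
    pselect (exists Y Y', [/\ M Y, M Y' & Y u != Y' u]).
    exists ((1 / 2)%:C *: (Y + Y')); first exact: Mmid.
    have y0 : 0 < nr (Y u - Y' u) by rewrite nr_gt0// subr_eq0.
    exists (c * (1 - r ^+ 2) * nr (Y u - Y' u) ^+ 2 / 4).
      by rewrite divr_gt0// !mulr_gt0 ?exprn_gt0//; lra.
    move=> X a MX; apply: le_trans (slack_midpoint _ _ _ _ _ _).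
    have h1 := sM X Y u a MX MY; have h2 := sM X Y' u a MX MY'.
    have : c * nr (Y u - Y' u) ^+ 2 * ((1 - r ^+ 2) * nr a ^+ 2) <=
       c * nr (Y u - Y' u) ^+ 2 * defect X a.
      rewrite ler_wpM2l ?dM// mulr_ge0 ?sqr_ge0//; lra.
    by move: h1 h2; clear; lra.
  exists A0 => //; exists ((c - 1) * ((1 - r ^+ 2) * nr u ^+ 2) * (1 - r ^+ 2)).
    by rewrite !mulr_gt0 ?exprn_gt0// subr_gt0.
  move=> X a MX; have XA : X u = A0 u.
    by apply: contrapT => /eqP neq; apply: agree; exists X, A0.
  have := defect_cauchy_schwarz u a (M1 X MX).
  rewrite /defect_form XA => h; rewrite /slack.
  have DE : defect A0 u = defect X u by rewrite /defect XA.
  have du := dM X u MX; have da := dM X a MX; rewrite DE.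
  have : (1 - r ^+ 2) * nr u ^+ 2 * ((1 - r ^+ 2) * nr a ^+ 2) <=
      defect X u * defect X a.
    by rewrite ler_pM// mulr_ge0 ?sqr_ge0// ltW.
  move=> k; have c1' : 0 <= c - 1 by lra.
  have := ler_wpM2l c1' k; move: h; clear; lra.
have local u : u != 0 -> exists2 U, nbhs u U & good U.
  move=> u_neq0; have [A MA [e e0 hA]] := pointwise u u_neq0.
  pose L := 4 * (nr u + 1) * (c + 2).
  have m0 := nr_ge0 u.
  have L0 : 0 < L by rewrite /L !mulr_gt0//; lra.
  pose d := Num.min 1 (e / 2 / L).
  have d0 : 0 < d by rewrite lt_min ltr01 !divr_gt0.
  exists [set v | nr (v - u) < d].
    have d0' : 0 < d%:C by rewrite ltcR.
    have := nbhsx_ballx u _ d0'.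
    apply: filterS => v; rewrite -ball_normE /= => uv.
    by rewrite nr_distC -ltcR nrE.
  exists A => //; exists (e / 2 / (nr u + 1) ^+ 2).
    by rewrite !divr_gt0// exprn_gt0//; lra.
  move=> v X a /=; rewrite lt_min => /andP[d1 d2] MX.
  have c0 : 0 <= c by lra.
  apply: le_trans (slack_perturb a (M1 X MX) (M1 A MA) c0 (ltW d1)).
  rewrite -/L; have a2 : 0 <= nr a ^+ 2 by exact: sqr_ge0.
  have h1 : L * nr (v - u) <= e / 2.
    by move: d2; rewrite ltr_pdivlMr// mulrC => /ltW.
  have h2 : nr v <= nr u + 1.
    by have := nrD u (v - u); rewrite addrC subrK; lra.
  have h3 : e / 2 / (nr u + 1) ^+ 2 * nr v ^+ 2 <= e / 2.
    rewrite mulrAC ler_pdivrMr; last by rewrite exprn_gt0//; lra.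
    by rewrite ler_wpM2l ?divr_ge0 ?(ltW e0)// lerXn2r ?nnegrE ?nr_ge0//; lra.
  have h4 := hA X a MX.
  have h5 := ler_wpM2r a2 h1; have h6 := ler_wpM2r a2 h3.
  by move: h4 h5 h6; clear; lra.
have [A MA [e e0 hA]] : good S.
  apply: contrapT => notgood.
  (* The complements in S of the sets of good directions generate a filter; a
     cluster point of it would have a good neighbourhood. *)
  pose F (W : set K) := exists2 U, good U & S `\` U `<=` W.
  have FF : ProperFilter F.
    apply: Build_ProperFilter.
      move=> [U gU SU]; apply: notgood; case: gU => A MA [e e0 hA].
      exists A => //; exists e => // u X a Su MX; apply: hA => //.
      by apply: contrapT => nU; apply: (SU u).
    split.
    - exists set0; last by [].
      by exists A0 => //; exists 1 => // u X a [].
    - move=> W1 W2 [U1 g1 s1] [U2 g2 s2]; exists (U1 `|` U2); first exact: goodU.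
      move=> x [Sx nU]; split; [apply: s1 | apply: s2]; split => // Ux; apply: nU.
        by left.
      by right.
    - by move=> W1 W2 W12 [U g s]; exists U => // x /s; exact: W12.
  have FS : F S.
    exists set0; last by move=> x [].
    by exists A0 => //; exists 1 => // u X a [].
  have [u [Su clu]] := cS F FF FS.
  have u_neq0 : u != 0 by apply/eqP => u0; apply: S0; rewrite -u0.
  have [U nU gU] := local u u_neq0.
  have FnU : F (S `\` U) by exists U.
  by have [x [[_ nUx] Ux]] := clu _ _ FnU nU.
exists A => //; exists (c - e); first by rewrite gtrBl.
move=> X MX; apply/cosh2_leP => u a.
have key : e * nr u ^+ 2 * nr a ^+ 2 <= slack c X A u a.
  have [->|u_neq0] := eqVneq u 0.
    by rewrite nr0 expr0n /= mulr0 mul0r; exact: sM.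
  have [k Sk] := Sscale u u_neq0.
  have k0 : 0 < nr k.
    by apply: nr_gt0; apply/eqP => k0; apply: S0; rewrite k0 scale0r in Sk.
  have := hA _ X a Sk MX; rewrite slackZ nrZ exprMn.
  rewrite (_ : e * _ * _ = nr k ^+ 2 * (e * nr u ^+ 2 * nr a ^+ 2)).
    by rewrite ler_pM2l// exprn_gt0.
  by ring.
have DA := defect_ge0 u (M1 A MA); have DX := defect_ge0 a (M1 X MX).
have : e * (defect A u * defect X a) <= e * (nr u ^+ 2 * nr a ^+ 2).
  by rewrite ler_wpM2l ?(ltW e0)// ler_pM// defect_le.
by move: key; rewrite /slack; clear; lra.
Qed.

End NonDiametral.

(** * Intersections of chains of closed convex sets *)

Section DecreasingIntersections.
Context {R : realType} {H K : hilbertType R[i]}.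
Hypothesis finK : finite_dimensional K.
Implicit Types (X Y : 'L(K, H)) (u : K) (M : set 'L(K, H)).

Lemma hilbert_complete (E : hilbertType R[i]) (x : nat -> E) :
  (forall e : R, 0 < e -> exists N, forall j k, (N <= j)%N -> (N <= k)%N ->
     nr (x j - x k) < e) ->
  exists l, forall e : R, 0 < e -> exists N, forall k, (N <= k)%N ->
     nr (l - x k) < e.
Proof.
move=> cx.
have cvgx : cvg (x @ \oo).
  apply: cauchy_cvg; apply: cauchy_exP => e e0; have [eE e1] := Re_gt0 e0.
  have [N hN] := cx _ e1; exists (x N); exists N => // k /= Nk.
  by rewrite -ball_normE /= -nrE -eE ltcR; exact: hN.
exists (lim (x @ \oo)) => e e0.
have /cvgrPdist_lt/(_ e%:C) := cvgx; rewrite ltcR => /(_ e0)[N _ hN].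
exists N => k Nk; have := hN k Nk; rewrite /= -nrE ltcR; exact.
Qed.

Lemma pointwise_limit (x : nat -> 'L(K, H)) : (forall k, nr (x k) <= 1) ->
  (forall u (e : R), 0 < e -> exists N, forall j k, (N <= j)%N -> (N <= k)%N ->
     nr (x j u - x k u) < e) ->
  exists X, forall u (e : R), 0 < e -> exists N, forall k, (N <= k)%N ->
     nr (X u - x k u) < e.
Proof.
move=> x1 cx.
have /choice[f fP] : forall u, exists l, forall e : R, 0 < e ->
    exists N, forall k, (N <= k)%N -> nr (l - x k u) < e.
  by move=> u; apply: hilbert_complete; exact: cx.
have small (v : H) : (forall e : R, 0 < e -> nr v <= e) -> v = 0.
  move=> h; apply: nr_eq0; apply/eqP; rewrite eq_le nr_ge0 andbT.
  by apply/ler_addgt0Pr => e e0; rewrite add0r h.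
have lin_f : linear f.
  move=> a u v; apply/eqP; rewrite -subr_eq0; apply/eqP; apply: small => e e0.
  have a0 := nr_ge0 a; have a1 : 0 < nr a + 1 by lra.
  have e3 : 0 < e / 3 by rewrite divr_gt0.
  have e4 : 0 < e / 3 / (nr a + 1) by rewrite divr_gt0.
  have [N1 h1] := fP (a *: u + v) _ e3; have [N2 h2] := fP u _ e4.
  have [N3 h3] := fP v _ e3.
  pose k := (maxn N1 (maxn N2 N3)).
  have {}h1 := h1 k (leq_maxl _ _).
  have {}h2 := h2 k (leq_trans (leq_maxl _ _) (leq_maxr _ _)).
  have {}h3 := h3 k (leq_trans (leq_maxr _ _) (leq_maxr _ _)).
  have -> : f (a *: u + v) - (a *: f u + f v) =
     (f (a *: u + v) - x k (a *: u + v)) - a *: (f u - x k u) - (f v - x k v).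
    by rewrite (app_linear (x k)); lmod.
  apply: le_trans (nrB _ _) _; apply: le_trans (lerD (nrB _ _) (lexx _)) _.
  rewrite nrZ.
  have : nr a * nr (f u - x k u) <= e / 3.
    apply: le_trans (ler_wpM2l a0 (ltW h2)) _.
    rewrite mulrA ler_pdivrMr// mulrC ler_wpM2l ?lerDl//; exact: ltW.
  move: h1 h3; clear; lra.
have fb u : nr (f u) <= 1 * nr u.
  rewrite mul1r; apply/ler_addgt0Pr => e e0; have [N hN] := fP u e e0.
  have := hN N (leqnn N); have := nrD (f u - x N u) (x N u); rewrite subrK.
  have := nr_app (x N) u; have : nr (x N) * nr u <= nr u.
    by rewrite ler_piMl ?nr_ge0.
  lra.
have [X XE] := op_of_linear lin_f fb.
by exists X => u e e0; rewrite XE; exact: fP.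
Qed.

(** The sum of the squared norms of the images of a basis makes the space of
    operators a Hilbert space; only the properties that are used are exported, so
    that no basis has to be carried along. *)
Lemma hilbert_schmidt : exists hs : 'L(K, H) -> R,
  [/\ forall X, 0 <= hs X,
      forall X Y, hs ((1 / 2)%:C *: (X + Y)) = (hs X + hs Y) / 2 - hs (X - Y) / 4,
      forall u, exists2 C : R, 0 < C & forall X, nr (X u) ^+ 2 <= C * hs X &
      exists B : R, forall X, nr X <= 1 -> hs X <= B].
Proof.
have [n [c [e [ceK ecK]]]] := coordinates finK.
pose b i := e (delta_mx 0 i).
pose hs (X : 'L(K, H)) : R := \sum_i nr (X (b i)) ^+ 2.
have hs0 X : 0 <= hs X by apply: sumr_ge0 => i _; exact: sqr_ge0.
exists hs; split => //.
- move=> X Y; rewrite /hs -big_split !mulr_suml -sumrB; apply: eq_bigr => i _.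
  exact: parallelogram.
- move=> u; pose w := c u.
  pose S := \sum_i nr (w 0 i); have S0 : 0 <= S by apply: sumr_ge0 => i _; exact: nr_ge0.
  exists (S ^+ 2 + 1); first by rewrite ltr_wpDl ?sqr_ge0.
  move=> X; apply: le_trans (_ : S ^+ 2 * hs X <= _); last first.
    by rewrite ler_wpM2r ?lerDl.
  have Xu : nr (X u) <= S * Num.sqrt (hs X).
    rewrite -(ceK u) (row_sum_delta (c u)) !linear_sum /S mulr_suml.
    apply: (big_ind2 (fun (v : H) (t : R) => nr v <= t)); first by rewrite nr0.
      by move=> u1 v1 u2 v2 h1 h2; apply: le_trans (nrD _ _) _; rewrite lerD.
    move=> i _; rewrite [v in nr v <= _](_ : _ = c u 0 i *: X (b i)); last first.
      by rewrite -(appZ X) -linearZ.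
    rewrite nrZ ler_wpM2l ?nr_ge0//.
    rewrite -(@ler_pXn2r _ 2) ?nnegrE ?nr_ge0 ?sqrtr_ge0// sqr_sqrtr//.
    rewrite /hs (bigD1 i)//= lerDl; apply: sumr_ge0 => j _; exact: sqr_ge0.
  rewrite -[X in _ * X](sqr_sqrtr (hs0 X)) -exprMn.
  by rewrite lerXn2r ?nnegrE ?nr_ge0 ?mulr_ge0 ?sqrtr_ge0.
- exists (\sum_i nr (b i) ^+ 2) => X X1; apply: ler_sum => i _.
  rewrite lerXn2r ?nnegrE ?nr_ge0//; apply: le_trans (nr_app _ _) _.
  by rewrite ler_piMl ?nr_ge0.
Qed.

Definition midpoint_closed M := forall X Y, M X -> M Y -> M ((1 / 2)%:C *: (X + Y)).

(** Closedness for pointwise convergence, the approximating operator being allowed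
    to depend on the vector. Balls have this strong form of closedness because each
    of their defining conditions involves a single value [Y u]. *)
Definition pointwise_closed M := forall X,
  (forall u (e : R), 0 < e -> exists2 Y, M Y & nr (X u - Y u) < e) -> M X.

(** Almost minimal elements, for the Hilbert-Schmidt norm, of smaller and smaller
    members of the chain form a Cauchy sequence by the parallelogram law: if two
    elements of a convex set have almost minimal norm, so has their midpoint. The
    limit belongs to every member of the chain. *)
Lemma chain_intersection (C : set (set 'L(K, H))) : C !=set0 ->
  total_on C subset ->
  (forall M, C M -> [/\ M !=set0, forall X, M X -> nr X <= 1,
     midpoint_closed M & pointwise_closed M]) ->
  exists X, forall M, C M -> M X.
Proof.
move=> [M0 CM0] tot CP.
have [hs [hs0 hsP hsu [B hsB]]] := hilbert_schmidt.
pose D M := inf (hs @` M).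
have Dinf M : C M -> has_inf (hs @` M).
  move=> /CP[[X MX] _ _ _]; split; first by exists (hs X), X.
  by exists 0 => _ [Y _ <-].
have Dle M X : C M -> M X -> D M <= hs X.
  by move=> CM MX; apply: ge_inf; [exact: (Dinf M CM).2 | exists X].
have DB M : C M -> D M <= B.
  move=> CM; have [[X MX] M1 _ _] := CP M CM.
  by apply: le_trans (Dle _ _ CM MX) (hsB _ (M1 _ MX)).
have supD : has_sup (D @` C).
  by split; [exists (D M0), M0 | exists B => _ [M CM <-]; exact: DB].
pose d := sup (D @` C).
have Dd M : C M -> D M <= d.
  by move=> CM; apply: ub_le_sup; [exact: supD.2 | exists M].
pose eps k : R := k.+1%:R^-1.
have eps0 k : 0 < eps k by rewrite invr_gt0 ltr0n.
(* The factor 8 is the 4 of the parallelogram law times the width 2 e of the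
   range of the squared norms. *)
have close M X Y e : C M -> M X -> M Y -> hs X < d + e -> hs Y < d + e ->
    d - e < D M -> hs (X - Y) <= 8 * e.
  move=> CM MX MY hX hY hM; have [_ _ Mm _] := CP M CM.
  have := Dle M _ CM (Mm X Y MX MY); rewrite hsP; lra.
have low M e : C M -> 0 < e -> exists2 X, M X & hs X < d + e.
  move=> CM e0; have [_ [X MX <-] hX] := inf_adherent e0 (Dinf M CM).
  exists X => //; apply: lt_le_trans hX _; rewrite lerD2r; exact: Dd.
have /choice[a aP] : forall k, exists a : set 'L(K, H) * 'L(K, H),
    [/\ C a.1, a.1 a.2, d - eps k < D a.1 & hs a.2 < d + eps k].
  move=> k; have [_ [M CM <-] hM] := sup_adherent (eps0 k) supD.
  by have [X MX hX] := low M (eps k) CM (eps0 k); exists (M, X).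
have eps_le k j : (k <= j)%N -> eps j <= eps k.
  by move=> kj; rewrite lef_pV2 ?posrE ?ltr0n// ler_nat.
have cl k j : (k <= j)%N -> hs ((a k).2 - (a j).2) <= 8 * eps k.
  move=> kj; have [C1 M1 D1 h1] := aP k; have [C2 M2 D2 h2] := aP j.
  have ekj := eps_le k j kj.
  have [sub|sub] := tot _ _ C1 C2.
    apply: (close (a j).1) => //; first exact: sub.
      by apply: lt_le_trans h2 _; rewrite lerD2l.
    by apply: le_lt_trans D2; rewrite lerD2l lerN2.
  apply: (close (a k).1) => //; first exact: sub.
  by apply: lt_le_trans h2 _; rewrite lerD2l.
have eps_small (e : R) : 0 < e -> exists k, eps k < e.
  move=> e0; exists (Num.bound e^-1); rewrite /eps.
  rewrite -[ltRHS]invrK ltf_pV2 ?posrE ?ltr0n ?invr_gt0//.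
  apply: lt_le_trans (archi_boundP _) _; first by rewrite invr_ge0 ltW.
  by rewrite ler_nat.
have hs_small u (e : R) : 0 < e -> exists k, forall X,
    hs X <= 8 * eps k -> nr (X u) < e.
  move=> e0; have [Cu Cu0 hC] := hsu u.
  have [k hk] := eps_small (e ^+ 2 / (8 * Cu)) ltac:(by rewrite divr_gt0 ?exprn_gt0// mulr_gt0).
  exists k => X hX; rewrite -(@ltr_pXn2r _ 2) ?nnegrE ?nr_ge0 ?(ltW e0)//.
  apply: le_lt_trans (hC X) _.
  apply: le_lt_trans (ler_wpM2l (ltW Cu0) hX) _.
  by move: hk; rewrite ltr_pdivlMr ?mulr_gt0//; lra.
have a1 k : nr (a k).2 <= 1.
  by have [Ck Mk _ _] := aP k; have [_ M1 _ _] := CP _ Ck; exact: M1.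
have cauchy u (e : R) : 0 < e -> exists N, forall j k, (N <= j)%N -> (N <= k)%N ->
    nr ((a j).2 u - (a k).2 u) < e.
  move=> e0; have [N hN] := hs_small u (e / 2) ltac:(by rewrite divr_gt0).
  exists N => j k Nj Nk.
  have h1 := hN _ (cl N j Nj); have h2 := hN _ (cl N k Nk).
  have -> : (a j).2 u - (a k).2 u =
     ((a N).2 - (a k).2) u - ((a N).2 - (a j).2) u.
    by rewrite !opDE !opNE; lmod.
  by apply: le_lt_trans (nrB _ _) _; lra.
have [X XP] := pointwise_limit a1 cauchy.
exists X => M CM; have [_ _ _ Mcl] := CP M CM.
apply: Mcl => u e e0.
have e2 : 0 < e / 2 by rewrite divr_gt0.
have [N1 h1] := XP u _ e2; have [N2 h2] := hs_small u _ e2.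
pose k := maxn N1 N2.
have [Ck Mk Dk hk] := aP k.
have [Y MY hY] : exists2 Y, M Y & hs ((a k).2 - Y) <= 8 * eps k.
  have [sub|sub] := tot _ _ Ck CM.
    exists (a k).2; first exact: sub.
    by apply: (close (a k).1).
  have [Y MY hY] := low M (eps k) CM (eps0 k).
  by exists Y => //; apply: (close (a k).1) => //; exact: sub.
exists Y => //.
have k2 : hs ((a k).2 - Y) <= 8 * eps N2.
  by apply: le_trans hY _; rewrite ler_wpM2l// eps_le// leq_maxr.
have {}h1 := h1 k (leq_maxl _ _); have {}h2 := h2 _ k2.
have -> : X u - Y u = (X u - (a k).2 u) + ((a k).2 - Y) u.
  by rewrite opDE opNE; lmod.
by apply: le_lt_trans (nrD _ _) _; lra.
Qed.

End DecreasingIntersections.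

(** * Minimal invariant sets *)

Section InvariantSets.
Context {R : realType} {H K : hilbertType R[i]}.
Hypothesis finK : finite_dimensional K.
Variable G : set (unit_ball 'L(K, H) -> unit_ball 'L(K, H)).
Hypothesis groupG : automorphism_group G.

Lemma cosh2_ball_midpoint (c : R) (N : set 'L(K, H)) :
  0 <= c -> (forall X, N X -> nr X <= 1) ->
  midpoint_closed [set Y | forall X, N X -> cosh2_le c X Y].
Proof.
move=> c0 N1 Y Y' hY hY' X NX; apply/cosh2_leP => u a.
apply: le_trans (slack_midpoint _ _ _ _ _ _).
have h1 := (cosh2_leP c X Y).1 (hY X NX) u a.
have h2 := (cosh2_leP c X Y').1 (hY' X NX) u a.
apply: addr_ge0; first by rewrite divr_ge0// addr_ge0.
apply: divr_ge0 => //; apply: mulr_ge0; last exact: sqr_ge0.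
by apply: mulr_ge0 => //; exact: defect_ge0 a (N1 X NX).
Qed.

(** The increment of [y ^ 2] is linear in [t], with a coefficient that depends on [x]
    only. *)
Lemma sqr_increment (x y t b : R) : 0 <= y -> 0 <= b -> 0 <= x -> 0 <= t <= 1 ->
  x <= y + t * b -> x ^+ 2 <= y ^+ 2 + t * (b * (2 * x + b)).
Proof.
move=> y0 b0 x0 /andP[t0 t1] xy.
have tb0 : 0 <= t * b by rewrite mulr_ge0.
have [xley|yltx] := leP x y.
  have s0 : 0 <= t * (b * (2 * x + b)).
    by rewrite mulrA mulr_ge0// addr_ge0// mulr_ge0.
  by apply: le_trans (lerXn2r 2 _ _ xley) _; rewrite ?nnegrE// lerDl.
have : (x - y) * (x + y) <= t * b * (2 * x + b).
  by apply: ler_pM; move: y0 b0 x0 xy yltx; clear; lra.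
by rewrite !expr2; clear; lra.
Qed.

Lemma cosh2_ball_closed (c : R) (N : set 'L(K, H)) :
  0 <= c -> (forall X, N X -> nr X <= 1) ->
  pointwise_closed [set Y | forall X, N X -> cosh2_le c X Y].
Proof.
move=> c0 N1 Y hY X NX u a.
set b := X a; set x := Y u; pose k := c * defect X a.
have k0 : 0 <= k by apply: mulr_ge0 => //; exact: defect_ge0 a (N1 X NX).
pose p (y : H) := nr (hdot u a - hdot y b).
have suff_x : p x ^+ 2 + k * nr x ^+ 2 <= k * nr u ^+ 2.
  pose L := nr b * (2 * p x + nr b) + k * (2 * nr x + 1).
  have b0 := nr_ge0 b; have x0 := nr_ge0 x.
  have px0 : 0 <= p x := nr_ge0 _.
  have L0 : 0 <= L by apply: addr_ge0; apply: mulr_ge0 => //; lra.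
  apply/ler_addgt0Pr => e e0.
  have L1 : 0 < L + 1 by lra.
  pose d := Num.min 1 (e / (L + 1)).
  have d0 : 0 < d by rewrite lt_min ltr01 divr_gt0.
  have [Z hZ] := hY u d d0; set y := Z u; rewrite lt_min => /andP[dy1 dy2].
  set t := nr (Y u - Z u) in dy1 dy2.
  have t0 : 0 <= t := nr_ge0 _.
  have hy : p y ^+ 2 + k * nr y ^+ 2 <= k * nr u ^+ 2.
    have := hZ X NX u a; rewrite -/b -/y -/(p y) /defect -/y => h.
    by rewrite /k /defect in h *; move: h; rewrite -/y; clear; lra.
  have pxy : p x <= p y + t * nr b.
    have -> : p x = nr ((hdot u a - hdot y b) - hdot (x - y) b).
      by rewrite /p dotBl; congr nr; ring.
    apply: le_trans (nrB _ _) _; rewrite lerD2l; exact: cauchy_schwarz.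
  have xy' : nr x <= nr y + t.
    by have := nrD y (x - y); rewrite addrC subrK.
  have y0 := nr_ge0 y; have py0 : 0 <= p y := nr_ge0 _.
  have t01 : 0 <= t <= 1 by rewrite t0 ltW.
  have c1 := sqr_increment py0 b0 px0 t01 pxy.
  rewrite -[t]mulr1 in xy'; have c2 := sqr_increment y0 ler01 x0 t01 xy'.
  rewrite mul1r in c2.
  have c3 := ler_wpM2l k0 c2.
  have tL : t * L <= e.
    rewrite ltr_pdivlMr// in dy2.
    apply: le_trans (ltW dy2); rewrite ler_wpM2l// lerDl.
    exact: ler01.
  by move: hy c1 c3 tL; rewrite /L; clear; lra.
by move: suff_x; rewrite /p /k /defect -/x -/b; clear; lra.
Qed.

Record admissible (r : R) (M : set 'L(K, H)) : Prop := Admissible {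
  adm_nonempty : M !=set0;
  adm_bounded : forall X, M X -> nr X <= r;
  adm_midpoint : midpoint_closed M;
  adm_closed : pointwise_closed M;
  adm_invariant : forall g (Z : unit_ball 'L(K, H)),
    G g -> M (val Z) -> M (val (g Z))
}.

Lemma group_holomorphic g : G g -> holomorphic g.
Proof. by case: groupG => aut _ _ _ /aut[h []]. Qed.

(** The intersection of the balls centred at the points of the orbit, with a common
    radius that is large enough for it to contain the orbit. *)
Lemma orbit_admissible (X0 : unit_ball 'L(K, H)) :
  separated_from_boundary (group_orbit G X0) ->
  exists2 r, r < 1 & exists M, admissible r M.
Proof.
have [_ G1 Gcomp Ginv] := groupG.
move=> [r r1 hr].
have orb_r X : group_orbit G X0 X -> nr (val X) <= r.
  by move=> /hr; rewrite -nrE lecR.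
have orb0 : group_orbit G X0 X0 by exists id.
have r0 : 0 <= r by apply: le_trans (orb_r _ orb0); exact: nr_ge0.
pose c := 4 / (1 - r ^+ 2) ^+ 2.
have q0 : 0 < 1 - r ^+ 2 by nra.
have c1 : 1 < c.
  rewrite /c ltr_pdivlMr ?exprn_gt0// mul1r.
  have : (1 - r ^+ 2) ^+ 2 <= 1.
    by rewrite expr_le1// ?(ltW q0)// gerBl sqr_ge0.
  lra.
have [s s1 hs] := cosh2_le_ball (orb_r _ orb0) r1 c1.
exists s => //.
pose N := [set val X | X in group_orbit G X0] : set 'L(K, H).
have N1 X : N X -> nr X <= 1 by move=> [Z /orb_r hZ <-]; lra.
exists [set Y | forall X, N X -> cosh2_le c X Y]; split.
- exists (val X0) => _ [Z hZ <-].
  by apply: cosh2_le_bounded => //; exact: orb_r.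
- by move=> Y hY; apply: hs; apply: hY; exists X0.
- by apply: cosh2_ball_midpoint => //; lra.
- by apply: cosh2_ball_closed => //; lra.
- move=> g Y Gg hY _ [Z [f Gf <-] <-].
  have [h Gh [gh hg]] := Ginv g Gg.
  rewrite -(hg (f X0)).
  apply: (cosh2_le_holomorphic finK) => //; first exact: group_holomorphic.
  by apply: hY; exists (h (f X0)) => //; exists (h \o f) => //; exact: Gcomp.
Qed.

Lemma minimal_admissible r M0 : r < 1 -> admissible r M0 ->
  exists2 M, admissible r M &
    forall N, admissible r N -> N `<=` M -> N = M.
Proof.
move=> r1 adm0; pose T := {M | admissible r M}.
pose below (M N : T) : bool := `[< sval N `<=` sval M >].
have [|||C tot|t tmin] := @Zorn T below.
- by move=> M; apply/asboolP.
- by move=> M N P /asboolP MN /asboolP NP; apply/asboolP; exact: subset_trans MN.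
- move=> [M adm_M] [N adm_N] /asboolP /= NM /asboolP /= MN.
  by apply: eq_exist; apply/seteqP.
- have [C0|/set0P/negP/negPn/eqP C0] := pselect (C !=set0); last first.
    by exists (exist _ M0 adm0) => s; rewrite C0.
  pose I := [set X | forall M, C M -> sval M X].
  suff admI : admissible r I.
    by exists (exist _ I admI) => s Cs; apply/asboolP => X; exact.
  have [M CM] := C0; have admM := svalP M.
  split.
  + have [|||X hX] := @chain_intersection _ _ _ finK [set sval M | M in C].
    * by exists (sval M), M.
    * move=> _ _ [P CP <-] [Q CQ <-].
      by case: (tot P Q CP CQ) => /asboolP; [right|left].
    * move=> _ [P CP <-]; have [P0 Pb Pm Pc _] := svalP P; split=> // X /Pb; lra.
    by exists X => P CP; apply: hX; exists P.
  + by move=> X /(_ M CM); exact: adm_bounded.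
  + by move=> X Y IX IY P CP; apply: (adm_midpoint (svalP P)); [exact: IX|exact: IY].
  + move=> X hX P CP; apply: (adm_closed (svalP P)) => u e e0.
    by have [Y IY XY] := hX u e e0; exists Y => //; exact: IY.
  + by move=> g X Gg IX P CP; apply: (adm_invariant (svalP P)) => //; exact: IX.
exists (sval t); first exact: (svalP t).
move=> N admN Nt; have := tmin (exist _ N admN) ltac:(by apply/asboolP).
by move=> <-.
Qed.

Lemma center_admissible r c M : r < 1 -> 1 < c -> admissible r M ->
  (exists2 A, M A & forall X, M X -> cosh2_le c X A) ->
  admissible r [set Y | M Y /\ forall X, M X -> cosh2_le c X Y].
Proof.
move=> r1 c1 [M0 Mb Mm Mc Mi] [A MA cA].
have [_ _ _ Ginv] := groupG.
have c0 : 0 <= c by lra.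
have M1 X : M X -> nr X <= 1 by move=> /Mb; lra.
split.
- by exists A.
- by move=> X [/Mb].
- move=> X Y [MX hX] [MY hY]; split; first exact: Mm.
  exact: (cosh2_ball_midpoint c0 M1 hX hY).
- move=> X hX; split.
    by apply: Mc => u e e0; have [Y [MY _] XY] := hX u e e0; exists Y.
  apply: (cosh2_ball_closed c0 M1) => u e e0.
  by have [Y [_ hY] XY] := hX u e e0; exists Y.
- move=> g X Gg [MX hX]; split; first exact: Mi.
  move=> Y MY.
  have [Z ZY] : exists Z : unit_ball 'L(K, H), val Z = Y.
    by apply: ball_of; have := Mb _ MY; lra.
  have [h Gh [gh hg]] := Ginv g Gg.
  rewrite -ZY -(hg Z); apply: (cosh2_le_holomorphic finK) => //.
    exact: group_holomorphic.
  by apply: hX; apply: Mi => //; rewrite ZY.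
Qed.

(** If the diameter were larger than 0, that is [d > 1] below, then the points whose
    distances to [M] are at most the number given by [nondiametral] would form a
    smaller admissible set: its diameter is smaller than that of [M]. *)
Lemma minimal_singleton r M : r < 1 -> admissible r M ->
  (forall N, admissible r N -> N `<=` M -> N = M) ->
  forall X Y, M X -> M Y -> X = Y.
Proof.
move=> r1 admM Mmin; have [[X0 MX0] Mb Mm Mc Mi] := admM.
have M1 X : M X -> nr X <= 1 by move=> /Mb; lra.
pose S := [set c : R | 1 < c /\ forall X Y, M X -> M Y -> cosh2_le c X Y].
have r0 : 0 <= r by apply: le_trans (Mb _ MX0); exact: nr_ge0.
have q0 : 0 < 1 - r ^+ 2 by nra.
have S0 : S (4 / (1 - r ^+ 2) ^+ 2).
  split; last by move=> X Y MX MY; apply: cosh2_le_bounded; rewrite ?Mb.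
  rewrite ltr_pdivlMr ?exprn_gt0// mul1r.
  have : (1 - r ^+ 2) ^+ 2 <= 1.
    by rewrite expr_le1// ?(ltW q0)// gerBl sqr_ge0.
  lra.
have infS : has_inf S.
  by split; [exists (4 / (1 - r ^+ 2) ^+ 2) | exists 1 => c [/ltW]].
set d := inf S.
have d1 : 1 <= d by apply: lb_le_inf; [exact: infS.1 | move=> c [/ltW]].
have Sd : forall X Y, M X -> M Y -> cosh2_le d X Y.
  move=> X Y MX MY; apply: cosh2_le_lim; rewrite ?M1// => e e0.
  have [c [c1 cS] cd] := inf_adherent e0 infS.
  by apply: cosh2_le_mono (cS X Y MX MY); rewrite ?M1// ltW.
have d_eq1 : d = 1.
  apply/eqP; rewrite eq_le d1 andbT leNgt; apply/negP => d_gt1.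
  have [A MA [c' c'd hA]] := nondiametral finK (adm_nonempty admM) Mb r1 Mm d_gt1 Sd.
  (* The maximum keeps c above 1, as invariance requires. *)
  pose c := Num.max c' ((1 + d) / 2).
  have c1 : 1 < c by rewrite lt_max; apply/orP; right; lra.
  have c'c : c' <= c by rewrite /c le_max lexx.
  have cd : c < d by rewrite gt_max c'd /=; lra.
  have admN := center_admissible r1 c1 admM (ex_intro2 _ _ A MA
    (fun X MX => cosh2_le_mono (M1 X MX) (M1 A MA) c'c (hA X MX))).
  have NM := Mmin _ admN (fun X h => h.1).
  have Sc : S c.
    split=> // X Y MX MY.
    have : [set Y | M Y /\ forall X, M X -> cosh2_le c X Y] Y by rewrite NM.
    by case=> _; exact.
  by have := ge_inf infS.2 Sc; rewrite -/d; lra.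
move=> X Y MX MY; apply: cosh2_le1_eq; rewrite ?M1//.
by rewrite -d_eq1; exact: Sd.
Qed.

End InvariantSets.

(** * The fixed point theorem *)

Theorem corollary3p11 (R : realType) (H K : hilbertType R[i])
    (finK : finite_dimensional K)
    (G : set (unit_ball 'L(K, H) -> unit_ball 'L(K, H)))
    (groupG : automorphism_group G)
    (sepG : exists X, separated_from_boundary (group_orbit G X)) :
  exists X, fixed_point G X.
Proof.
have [X0 sepX0] := sepG.
have [r r1 [M0 admM0]] := orbit_admissible finK groupG sepX0.
have [M admM Mmin] := minimal_admissible finK r1 admM0.
have single := minimal_singleton finK groupG r1 admM Mmin.
have [[X MX] Mb _ _ Mi] := admM.
have [Z ZX] : exists Z : unit_ball 'L(K, H), val Z = X.
  by apply: ball_of; have := Mb _ MX; lra.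
exists Z => g Gg; apply: val_inj; apply: single; last by rewrite ZX.
by apply: Mi => //; rewrite ZX.
Qed.
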